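(* Let $T$, $O$, $C$, $D$, $I$ denote the graphs ($1$-skeletons) of the tetrahedron, octahedron, cube, dodecahedron, and icosahedron, respectively. Then (a) $\rho^1_3(T) \ge 6$; (b) $\rho^1_3(O) \ge 9$; (c) $\rho^1_3(C) \ge 7$; (d) $\rho^1_3(D) \ge 9$; (e) $\rho^1_3(I) \ge 13$.
   Context: A crossing-free straight-line drawing of a graph $G$ in $\mathbb{R}^3$ represents the vertices by distinct points and each edge by the line segment connecting its endvertices, such that no edge passes through a vertex other than its endpoints and any two edges are disjoint except possibly at a common endpoint. The affine cover number $\rho^1_3(G)$ is the minimum number of straight lines in $\mathbb{R}^3$ such that $G$ has a crossing-free straight-line drawing in $\mathbb{R}^3$ contained in the union of these lines. *)

(* Defs.v *)
From HB Require Import structures.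
From mathcomp Require Import all_boot all_order all_algebra.
From mathcomp Require Import all_classical reals.
From mathcomp Require Import ring.

Set Implicit Arguments.
Unset Strict Implicit.
Unset Printing Implicit Defensive.

Import Order.TTheory GRing.Theory Num.Theory.

Local Open Scope classical_set_scope.
Local Open Scope ring_scope.

Record sgraph := SGraph {
  vertex :> finType;
  adj : rel vertex;
  adj_sym : symmetric adj;
  adj_irr : irreflexive adj }.

Section Drawing.
Variable R : realType.

Definition segment (p q : 'rV[R]_3) : set 'rV[R]_3 :=
  [set (1 - t) *: p + t *: q | t in `[0, 1]].

Definition is_line (L : set 'rV[R]_3) : Prop :=
  exists p d : 'rV[R]_3, d != 0 /\ L = [set p + t *: d | t in [set: R]].

Definition crossing_free (G : sgraph) (f : G -> 'rV[R]_3) : Prop :=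
  [/\ injective f,
      forall u v w : G, adj u v -> segment (f u) (f v) (f w) ->
        w = u \/ w = v
    & forall u v x y : G, adj u v -> adj x y ->
        [set u; v]%SET != [set x; y]%SET ->
        forall p, segment (f u) (f v) p -> segment (f x) (f y) p ->
        exists w : G, [/\ w \in [set u; v]%SET, w \in [set x; y]%SET & p = f w]].

Definition drawn_set (G : sgraph) (f : G -> 'rV[R]_3) : set 'rV[R]_3 :=
  range f `|` [set p | exists u v : G, adj u v /\ segment (f u) (f v) p].

(* Lines may be repeated, so this reads "at most k lines"; the least such k
   is unaffected. *)
Definition drawable_on_lines (G : sgraph) (k : nat) : Prop :=
  exists (f : G -> 'rV[R]_3) (L : 'I_k -> set 'rV[R]_3),
    [/\ crossing_free f,
        forall i, is_line (L i)
      & drawn_set f `<=` \bigcup_(i in [set: 'I_k]) L i].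

(* No four points of the moment curve are coplanar, so placing the vertices on
   it gives a crossing-free drawing of any finite graph. *)
Definition moment (a : R) : 'rV[R]_3 := \row_(j < 3) a ^+ j.+1.

Lemma moment_inj : injective moment.
Proof. by move=> a b /rowP/(_ ord0); rewrite !mxE !expr1. Qed.

Lemma moment_weights (a b c d t s : R) :
  (1 - t) *: moment a + t *: moment b = (1 - s) *: moment c + s *: moment d ->
  (1 - t) * ((a - b) * (a - c) * (a - d)) = 0 /\
  t * ((b - a) * (b - c) * (b - d)) = 0.
Proof.
move=> /rowP E.
have E1 := E (@Ordinal 3 0 isT); rewrite !mxE /= in E1.
have E2 := E (@Ordinal 3 1 isT); rewrite !mxE /= in E2.
have E3 := E (@Ordinal 3 2 isT); rewrite !mxE /= in E3.
pose l k := (1 - t) * a ^+ k + t * b ^+ k - ((1 - s) * c ^+ k + s * d ^+ k).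
have l1 : l 1%N = 0 by rewrite /l E1 subrr.
have l2 : l 2%N = 0 by rewrite /l E2 subrr.
have l3 : l 3%N = 0 by rewrite /l E3 subrr.
split.
- transitivity (l 3%N - (b + c + d) * l 2%N + (b * c + b * d + c * d) * l 1%N).
    by rewrite /l; ring.
  by rewrite l1 l2 l3 !mulr0 subrr addr0.
- transitivity (l 3%N - (a + c + d) * l 2%N + (a * c + a * d + c * d) * l 1%N).
    by rewrite /l; ring.
  by rewrite l1 l2 l3 !mulr0 subrr addr0.
Qed.

Lemma moment_endpoint (a b c d : R) p : a != b ->
  ~ (a = c /\ b = d) -> ~ (a = d /\ b = c) ->
  segment (moment a) (moment b) p -> segment (moment c) (moment d) p ->
  p = moment a \/ p = moment b.
Proof.
move=> ab Nac Nad [t _ <-] [s _ /esym E].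
have [/eqP A /eqP B] := moment_weights E.
have [->|t0] := eqVneq t 0; first by left; rewrite subr0 scale1r scale0r addr0.
have [->|t1] := eqVneq t 1; first by right; rewrite subrr scale1r scale0r add0r.
have t1' : 1 - t != 0 by rewrite subr_eq0 eq_sym.
move: A B; rewrite !mulf_eq0 (negPf t0) (negPf t1') /= !subr_eq0 (negPf ab).
rewrite eq_sym in ab; rewrite (negPf ab) /=.
case/orP=> /eqP Ea; case/orP=> /eqP Eb; subst; rewrite ?eqxx // in ab.
- by case: Nac.
- by case: Nad.
Qed.

Lemma drawable_on_lines_ex (G : sgraph) : exists k, drawable_on_lines G k.
Proof.
pose z (v : G) : R := (enum_rank v)%:R.
have z_inj : injective z.
  by move=> u v /eqP; rewrite eqr_nat => /eqP /ord_inj /enum_rank_inj.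
pose f v := moment (z v).
have f_inj : injective f by move=> u v /moment_inj /z_inj.
have adjN (u v : G) : adj u v -> u != v.
  by apply: contraTneq => ->; rewrite adj_irr.
have seg0 p q : @segment p q p.
  by exists 0; rewrite /= ?in_itv /= ?lexx ?ler01 // subr0 scale1r scale0r addr0.
have segd (p q : 'rV[R]_3) : p != q -> q - p != 0 by rewrite subr_eq0 eq_sym.
pose e0 : 'rV[R]_3 := const_mx 1.
have e0N : e0 != 0.
  by apply/eqP => /rowP/(_ ord0); rewrite !mxE => /eqP; rewrite oner_eq0.
pose dir (u v : G) := if u == v then e0 else f v - f u.
pose L (i : 'I_#|{: G * G}|) : set 'rV[R]_3 :=
  let: (u, v) := enum_val i in [set f u + t *: dir u v | t in [set: R]].
exists #|{: G * G}|, f, L; split.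
- split=> //.
  + move=> u v w uv Hs.
    have [|wuv] := boolP ((w == u) || (w == v)).
      by case/orP=> /eqP; [left|right].
    have [wu wv] : w <> u /\ w <> v.
      by move: wuv; rewrite negb_or => /andP[/eqP ? /eqP ?].
    have [] := @moment_endpoint (z u) (z v) (z w) (z w) (f w) _ _ _ Hs (seg0 _ _).
    * by apply: contra_neq (adjN _ _ uv) => /z_inj.
    * by case=> /z_inj E; case: wu.
    * by case=> /z_inj E; case: wu.
    * by move/f_inj; left.
    * by move/f_inj; right.
  + move=> u v x y uv xy D p Hu Hx.
    have uvN := adjN _ _ uv; have xyN := adjN _ _ xy.
    have N1 : ~ (u = x /\ v = y) by case=> ? ?; subst; rewrite eqxx in D.
    have N2 : ~ (u = y /\ v = x) by case=> ? ?; subst; rewrite finset.setUC eqxx in D.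
    have zN a b : a != b -> z a != z b by apply: contra_neq => /z_inj.
    have P1 : p = f u \/ p = f v.
      apply: (@moment_endpoint _ _ (z x) (z y)) Hu Hx; first exact: zN.
        by case=> /z_inj ? /z_inj ?; case: N1.
      by case=> /z_inj ? /z_inj ?; case: N2.
    have P2 : p = f x \/ p = f y.
      apply: (@moment_endpoint _ _ (z u) (z v)) Hx Hu; first exact: zN.
        by case=> /z_inj ? /z_inj ?; case: N1.
      by case=> /z_inj ? /z_inj ?; case: N2.
    case: P1 => P1; [exists u|exists v]; split=> //;
      rewrite ?finset.in_set2 ?eqxx ?orbT //;
      by case: P2; rewrite P1 => /f_inj ->; rewrite eqxx ?orbT.
- move=> i; rewrite /L; case: (enum_val i) => u v.
  exists (f u), (dir u v); split; last by [].
  rewrite /dir; have [_|uv] := eqVneq u v; first exact: e0N.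
  by apply: segd; apply: contra_neq uv => /f_inj.
- move=> p [[u _ <-]|[u [v [uv [t _ <-]]]]].
    exists (enum_rank (u, u)) => //; rewrite /L enum_rankK.
    by exists 0 => //; rewrite scale0r addr0.
  exists (enum_rank (u, v)) => //; rewrite /L enum_rankK.
  exists t => //; rewrite /dir (negPf (adjN _ _ uv)).
  by rewrite scalerBl scale1r scalerBr addrA addrAC.
Qed.

Lemma drawable_on_lines_exb (G : sgraph) :
  exists k, `[< drawable_on_lines G k >].
Proof. by have [k Gk] := drawable_on_lines_ex G; exists k; apply/asboolP. Qed.

Definition affine_cover_number (G : sgraph) : nat :=
  ex_minn (drawable_on_lines_exb G).

End Drawing.

Section Skeleton.
Variables (n : nat) (faces : seq (seq nat)).

Definition skeleton_adj : rel 'I_n := fun i j =>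
  (i != j) &&
  has (fun F => (next F (val i) == val j) || (next F (val j) == val i)) faces.

Lemma skeleton_sym : symmetric skeleton_adj.
Proof.
by move=> i j; rewrite /skeleton_adj eq_sym; congr (_ && _);
   apply: eq_has => F; rewrite orbC.
Qed.

Lemma skeleton_irr : irreflexive skeleton_adj.
Proof. by move=> i; rewrite /skeleton_adj eqxx. Qed.

(* Graph of a polyhedron with vertices 0, ..., n - 1, each face being given by
   its vertices in cyclic order; [next F i] is the successor of i along F
   (and i itself when i is not on F). *)
Definition skeleton : sgraph := SGraph skeleton_sym skeleton_irr.

End Skeleton.

Definition tetrahedron_faces : seq (seq nat) :=
  [:: [:: 0; 1; 2]; [:: 0; 1; 3]; [:: 0; 2; 3]; [:: 1; 2; 3]]%N.

(* 0 and 5 are the poles, 1, 2, 3, 4 the equator. *)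
Definition octahedron_faces : seq (seq nat) :=
  [:: [:: 0; 1; 2]; [:: 0; 2; 3]; [:: 0; 3; 4]; [:: 0; 4; 1];
      [:: 5; 1; 2]; [:: 5; 2; 3]; [:: 5; 3; 4]; [:: 5; 4; 1]]%N.

Definition cube_faces : seq (seq nat) :=
  [:: [:: 0; 1; 2; 3]; [:: 4; 5; 6; 7];
      [:: 0; 1; 5; 4]; [:: 1; 2; 6; 5]; [:: 2; 3; 7; 6]; [:: 3; 0; 4; 7]]%N.

(* 0-4 top face, 5-9 their neighbours below, 15-19 bottom face, 10-14 their
   neighbours above. *)
Definition dodecahedron_faces : seq (seq nat) :=
  [:: [:: 0; 1; 2; 3; 4];
      [:: 0; 1; 6; 10; 5]; [:: 1; 2; 7; 11; 6]; [:: 2; 3; 8; 12; 7];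
      [:: 3; 4; 9; 13; 8]; [:: 4; 0; 5; 14; 9];
      [:: 15; 16; 11; 6; 10]; [:: 16; 17; 12; 7; 11]; [:: 17; 18; 13; 8; 12];
      [:: 18; 19; 14; 9; 13]; [:: 19; 15; 10; 5; 14];
      [:: 15; 16; 17; 18; 19]]%N.

(* 0 and 11 are the poles, 1-5 and 6-10 the pentagons around them. *)
Definition icosahedron_faces : seq (seq nat) :=
  [:: [:: 0; 1; 2]; [:: 0; 2; 3]; [:: 0; 3; 4]; [:: 0; 4; 5]; [:: 0; 5; 1];
      [:: 1; 2; 6]; [:: 2; 3; 7]; [:: 3; 4; 8]; [:: 4; 5; 9]; [:: 5; 1; 10];
      [:: 6; 7; 2]; [:: 7; 8; 3]; [:: 8; 9; 4]; [:: 9; 10; 5]; [:: 10; 6; 1];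
      [:: 11; 6; 7]; [:: 11; 7; 8]; [:: 11; 8; 9]; [:: 11; 9; 10];
      [:: 11; 10; 6]]%N.

Definition tetrahedron : sgraph := skeleton 4 tetrahedron_faces.
Definition octahedron : sgraph := skeleton 6 octahedron_faces.
Definition cube : sgraph := skeleton 8 cube_faces.
Definition dodecahedron : sgraph := skeleton 20 dodecahedron_faces.
Definition icosahedron : sgraph := skeleton 12 icosahedron_faces.

(* Sanity check on the face lists: every face is a p-gon, every vertex lies on
   q faces, every edge lies on exactly two faces, and V + F = E + 2. *)
Definition schlafli (n : nat) (faces : seq (seq nat)) (p q : nat) : bool :=
  let on_face i j F := (next F i == j) || (next F j == i) in
  let deg2 i j := count (on_face i j) faces in
  let pairs := [seq (i, j) | i <- iota 0 n, j <- iota i.+1 (n - i.+1)] in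
  let edges := [seq e <- pairs | (deg2 e.1 e.2 != 0)%N] in
  [&& all (fun F => [&& uniq F, size F == p & all (fun i => i < n)%N F]) faces,
      all (fun i => count (fun F => i \in F) faces == q) (iota 0 n),
      all (fun e => deg2 e.1 e.2 == 2) edges
    & (n + size faces == size edges + 2)%N].

Lemma tetrahedron_schlafli : schlafli 4 tetrahedron_faces 3 3.
Proof. by vm_compute. Qed.
Lemma octahedron_schlafli : schlafli 6 octahedron_faces 3 4.
Proof. by vm_compute. Qed.
Lemma cube_schlafli : schlafli 8 cube_faces 4 3.
Proof. by vm_compute. Qed.
Lemma dodecahedron_schlafli : schlafli 20 dodecahedron_faces 5 3.
Proof. by vm_compute. Qed.
Lemma icosahedron_schlafli : schlafli 12 icosahedron_faces 3 5.
Proof. by vm_compute. Qed.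

(* Main.v *)
Require Import Defs.
From mathcomp Require Import all_boot all_order all_algebra.
From mathcomp Require Import all_classical reals.
From mathcomp Require Import ring lra zify.

Set Implicit Arguments.
Unset Strict Implicit.
Unset Printing Implicit Defensive.

Import Order.TTheory GRing.Theory Num.Theory.

Local Open Scope set_scope.
Local Open Scope ring_scope.

(* Call a vertex extremal if it is not strictly between two others; a maximiser
   of a linear functional can be chosen extremal, so there are three
   non-collinear extremal vertices.  No two edges at an extremal vertex are
   collinear, so it lies on as many lines as its degree, and two vertices share
   at most one line: three extremal vertices of degree d need 3d - 3 lines.
   This settles the tetrahedron and the octahedron.

   Cube and dodecahedron: a vertex on l lines uses up l (l - 1) / 2 pairs of
   lines.  Counting pairs, with too few lines the drawing is planar.  If a is
   the rightmost vertex, its middle edge points into the polygon formed by the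
   face spanned by the outer two edges, and so all vertices off this face are
   inside the polygon; hence the extreme points are on one face, and some of
   them are adjacent.  A line through adjacent extremal vertices contains no
   other vertex, which wastes too many pairs.

   Icosahedron on 12 lines: there are only three extremal vertices A, B, C, and
   every line passes through one of them.  Each of the 9 other vertices lies on
   three cevians of the triangle A B C, three from each corner.  In barycentric
   coordinates y/z, z/x and their product y/x are constant on the cevians from
   A, B and C; but the products of three by three distinct positive numbers
   take at least five values, not three. *)

(** * Euclidean space *)

Section Space.
Variable R : realType.
Implicit Types p q r u v w : 'rV[R]_3.

Definition c0 : 'I_3 := @Ordinal 3 0 isT.
Definition c1 : 'I_3 := @Ordinal 3 1 isT.
Definition c2 : 'I_3 := @Ordinal 3 2 isT.

Lemma row3P u v : u 0 c0 = v 0 c0 -> u 0 c1 = v 0 c1 -> u 0 c2 = v 0 c2 -> u = v.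
Proof.
move=> h0 h1 h2; apply/rowP => -[[|[|[|//]]] m].
- by rewrite (_ : Ordinal m = c0) //; apply: val_inj.
- by rewrite (_ : Ordinal m = c1) //; apply: val_inj.
- by rewrite (_ : Ordinal m = c2) //; apply: val_inj.
Qed.

Definition dot u v : R := u 0 c0 * v 0 c0 + u 0 c1 * v 0 c1 + u 0 c2 * v 0 c2.

Definition cross u v : 'rV[R]_3 :=
  \row_j (if j == c0 then u 0 c1 * v 0 c2 - u 0 c2 * v 0 c1
          else if j == c1 then u 0 c2 * v 0 c0 - u 0 c0 * v 0 c2
          else u 0 c0 * v 0 c1 - u 0 c1 * v 0 c0).

Lemma dotC u v : dot u v = dot v u.
Proof. by rewrite /dot; ring. Qed.

Lemma dotD w u v : dot w (u + v) = dot w u + dot w v.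
Proof. by rewrite /dot !mxE; ring. Qed.

Lemma dotZ w a u : dot w (a *: u) = a * dot w u.
Proof. by rewrite /dot !mxE; ring. Qed.

Lemma dotDl u v w : dot (u + v) w = dot u w + dot v w.
Proof. by rewrite !(dotC _ w) dotD. Qed.

Lemma dotZl a u w : dot (a *: u) w = a * dot u w.
Proof. by rewrite !(dotC _ w) dotZ. Qed.

Lemma dotN w u : dot w (- u) = - dot w u.
Proof. by rewrite /dot !mxE; ring. Qed.

Lemma dotNl u w : dot (- u) w = - dot u w.
Proof. by rewrite !(dotC _ w) dotN. Qed.

Lemma dotB w u v : dot w (u - v) = dot w u - dot w v.
Proof. by rewrite dotD dotN. Qed.

Lemma dotuu_ge0 u : 0 <= dot u u.
Proof. by rewrite !addr_ge0 // -expr2 sqr_ge0. Qed.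

Lemma dotuu_eq0 u : (dot u u == 0) = (u == 0).
Proof.
apply/eqP/eqP => [h|->]; last by rewrite /dot !mxE; ring.
have := sqr_ge0 (u 0 c0); have := sqr_ge0 (u 0 c1); have := sqr_ge0 (u 0 c2).
move: h; rewrite /dot -!expr2 => h h2 h1 h0.
have z0 : u 0 c0 ^+ 2 = 0 by lra.
have z1 : u 0 c1 ^+ 2 = 0 by lra.
have z2 : u 0 c2 ^+ 2 = 0 by lra.
by apply: row3P; rewrite mxE; apply/eqP; rewrite -sqrf_eq0 ?z0 ?z1 ?z2.
Qed.

Lemma dotuu_gt0 u : (0 < dot u u) = (u != 0).
Proof. by rewrite lt_def dotuu_ge0 andbT dotuu_eq0. Qed.

(** Up to sign, [dot u u *: v - dot u v *: u] is the double cross product of [u], [u] and [v], so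
    its entries are combinations of those of [cross u v]. *)
Lemma cross_eq0 u v : u != 0 -> cross u v = 0 -> v = dot u v / dot u u *: u.
Proof.
move=> u0 /rowP h.
have uu : dot u u != 0 by rewrite dotuu_eq0.
have h0 : u 0 c1 * v 0 c2 - u 0 c2 * v 0 c1 = 0 by have := h c0; rewrite !mxE.
have h1 : u 0 c2 * v 0 c0 - u 0 c0 * v 0 c2 = 0 by have := h c1; rewrite !mxE.
have h2 : u 0 c0 * v 0 c1 - u 0 c1 * v 0 c0 = 0 by have := h c2; rewrite !mxE.
apply: (scalerI uu); rewrite scalerA mulrCA divff // mulr1.
apply: row3P; rewrite !mxE; apply/eqP; rewrite -subr_eq0; apply/eqP.
- rewrite (_ : _ - _ = u 0 c2 * (u 0 c2 * v 0 c0 - u 0 c0 * v 0 c2)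
    - u 0 c1 * (u 0 c0 * v 0 c1 - u 0 c1 * v 0 c0)); last by rewrite /dot; ring.
  by rewrite h1 h2 !mulr0 subrr.
- rewrite (_ : _ - _ = u 0 c0 * (u 0 c0 * v 0 c1 - u 0 c1 * v 0 c0)
    - u 0 c2 * (u 0 c1 * v 0 c2 - u 0 c2 * v 0 c1)); last by rewrite /dot; ring.
  by rewrite h0 h2 !mulr0 subrr.
- rewrite (_ : _ - _ = u 0 c1 * (u 0 c1 * v 0 c2 - u 0 c2 * v 0 c1)
    - u 0 c0 * (u 0 c2 * v 0 c0 - u 0 c0 * v 0 c2)); last by rewrite /dot; ring.
  by rewrite h0 h1 !mulr0 subrr.
Qed.

(** [y] and [z] are [cross v n] and [cross n u] divided by the squared norm of [n]: the dual basis
    of [u], [v] in their plane. *)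
Lemma plane_coordinates (u v : 'rV[R]_3) (n := cross u v) : n != 0 ->
  exists y z : 'rV[R]_3, [/\ dot y u = 1, dot y v = 0, dot z u = 0, dot z v = 1
    & forall w, dot n w = 0 -> w = dot y w *: u + dot z w *: v].
Proof.
move=> n0; have nn : dot n n != 0 by rewrite dotuu_eq0.
have nnE : dot n n = dot u u * dot v v - dot u v ^+ 2.
  by rewrite /n /dot !mxE /=; ring.
exists ((dot n n)^-1 *: cross v n), ((dot n n)^-1 *: cross n u).
have yE w : dot (cross v n) w = dot v v * dot u w - dot u v * dot v w.
  by rewrite /n /dot !mxE /=; ring.
have zE w : dot (cross n u) w = dot u u * dot v w - dot u v * dot u w.
  by rewrite /n /dot !mxE /=; ring.
have yu : dot (cross v n) u = dot n n by rewrite yE nnE (dotC v u); ring.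
have zv : dot (cross n u) v = dot n n by rewrite zE nnE; ring.
have yv : dot (cross v n) v = 0 by rewrite yE; ring.
have zu : dot (cross n u) u = 0 by rewrite zE (dotC v u); ring.
split; rewrite ?dotZl ?yu ?zv ?yv ?zu ?mulr0 ?mulVf // => w nw; rewrite !dotZl.
apply: (scalerI nn); rewrite scalerDr !scalerA !mulVKf //.
transitivity (dot (cross v n) w *: u + dot (cross n u) w *: v + dot n w *: n).
  by rewrite /n /dot; apply: row3P; rewrite !mxE /=; ring.
by rewrite nw scale0r addr0.
Qed.

Definition strictly_between p q r : Prop :=
  exists2 t : R, 0 < t < 1 & q = (1 - t) *: p + t *: r.

Lemma line_span M p q r : is_line M -> M p -> M q -> p != q ->
  M r <-> exists s, r = p + s *: (q - p).
Proof.
move=> [o [d [d0 ->]]] [a _ <-] [b _ <-] ne.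
have ab : b - a != 0.
  by apply: contra_neq ne => /eqP; rewrite subr_eq0 => /eqP ->.
split=> [[c _ <-]|[s ->]].
- exists ((c - a) / (b - a)); apply: row3P; rewrite !mxE; field; exact: ab.
- by exists (a + s * (b - a)) => //; apply: row3P; rewrite !mxE; ring.
Qed.

Lemma line_eq M N p q : is_line M -> is_line N -> p != q ->
  M p -> M q -> N p -> N q -> M = N.
Proof.
move=> lM lN pq Mp Mq Np Nq; apply/seteqP; split=> r.
- by move=> /(line_span r lM Mp Mq pq) h; apply/(line_span r lN Np Nq pq).
- by move=> /(line_span r lN Np Nq pq) h; apply/(line_span r lM Mp Mq pq).
Qed.

Lemma line_trichotomy M p q r : is_line M -> M p -> M q -> M r ->
  p != q -> p != r -> q != r ->
  [\/ strictly_between q p r, strictly_between p q r | strictly_between p r q].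
Proof.
move=> lM Mp Mq Mr pq pr qr.
have [s rE] := (line_span r lM Mp Mq pq).1 Mr.
have s0 : s != 0 by apply: contra_neq pr => s0; rewrite rE s0 scale0r addr0.
have s1 : s != 1 by apply: contra_neq qr => s1; rewrite rE s1 scale1r addrC subrK.
move=> {pq pr qr}.
have [s_lt0|s_gt0|/eqP] := ltgtP s 0; last by rewrite (negPf s0).
- have h : 1 - s != 0 by rewrite subr_eq0 eq_sym.
  constructor 1; exists (1 / (1 - s)).
    by rewrite divr_gt0 ?ltr_pdivrMr /=; lra.
  by rewrite rE; apply: row3P; rewrite !mxE; field; exact: h.
- have [s_lt1|s_gt1|/eqP] := ltgtP s 1; last by rewrite (negPf s1).
    constructor 3; exists s; first by rewrite s_gt0.
    by rewrite rE; apply: row3P; rewrite !mxE; ring.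
  constructor 2; exists (1 / s).
    by rewrite divr_gt0 ?ltr_pdivrMr /=; lra.
  by rewrite rE; apply: row3P; rewrite !mxE; field; exact: s0.
Qed.

End Space.

(** * Extremal points of a finite configuration *)

Section Extremal.
Variables (R : realType) (V : finType) (f : V -> 'rV[R]_3).
Hypothesis f_inj : injective f.

Definition extremal v : Prop :=
  forall u w, strictly_between (f u) (f v) (f w) -> u = w.

Lemma exists_max (P : pred V) (F : V -> R) v0 : P v0 ->
  exists v, P v /\ forall u, P u -> F u <= F v.
Proof. by move=> Pv0; case: (arg_maxP F Pv0) => v Pv h; exists v; split. Qed.

(* Among the maximisers of the functional, one of largest norm is extremal,
   by strict convexity of the norm. *)
Lemma extremal_max (w : 'rV[R]_3) (v0 : V) :
  exists2 v, extremal v & forall u, dot w (f u) <= dot w (f v).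
Proof.
have [v1 [_ max1]] := @exists_max predT (fun v => dot w (f v)) v0 isT.
have [v [/eqP v_top max2]] := @exists_max
  (fun v => dot w (f v) == dot w (f v1)) (fun v => dot (f v) (f v)) v1 (eqxx _).
exists v => [u u' [t /andP[t0 t1] E]|u]; last by rewrite v_top max1.
have ht1 : 0 < 1 - t by lra.
have Eu := max1 u isT; have Eu' := max1 u' isT.
have Ew : (1 - t) * dot w (f u) + t * dot w (f u') = dot w (f v1).
  by rewrite -v_top E dotD !dotZ.
have top_u : dot w (f u) = dot w (f v1).
  apply/eqP; rewrite eq_le Eu /= -(ler_pM2l ht1) -subr_ge0.
  have : 0 <= t * (dot w (f v1) - dot w (f u')) by rewrite mulr_ge0; lra.
  lra.
have top_u' : dot w (f u') = dot w (f v1).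
  by apply: (mulfI (lt0r_neq0 t0)); rewrite top_u in Ew; lra.
have nu := max2 u (introT eqP top_u).
have nu' := max2 u' (introT eqP top_u').
apply: f_inj; apply/eqP; rewrite -subr_eq0 -dotuu_eq0.
(* Neither end has larger norm than [f v], so the defect in this identity, a positive multiple of
   the squared distance of the ends, is at most 0. *)
have D : dot (f v) (f v) = (1 - t) * dot (f u) (f u) + t * dot (f u') (f u')
    - t * (1 - t) * dot (f u - f u') (f u - f u').
  by rewrite E /dot !mxE; ring.
rewrite eq_le dotuu_ge0 andbT -(pmulr_rle0 _ (mulr_gt0 t0 ht1)).
have : (1 - t) * dot (f u) (f u) <= (1 - t) * dot (f v) (f v) by rewrite ler_pM2l.
have : t * dot (f u') (f u') <= t * dot (f v) (f v) by rewrite ler_pM2l.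
lra.
Qed.

Definition noncollinear (a b c : V) : Prop :=
  cross (f b - f a) (f c - f a) != 0.

Lemma cross_line (M : set 'rV[R]_3) a b c : is_line M ->
  M (f a) -> M (f b) -> M (f c) -> ~ noncollinear a b c.
Proof.
rewrite /noncollinear => -[o [d [d0 ->]]] [x _ <-] [y _ <-] [z _ <-].
apply/negP; rewrite negbK; apply/eqP.
by apply: row3P; rewrite !mxE /=; ring.
Qed.

Lemma cross0_line (M : set 'rV[R]_3) a b c : is_line M ->
  M (f a) -> M (f b) -> a != b -> ~ noncollinear a b c -> M (f c).
Proof.
move=> lM Ma Mb ab /negP; rewrite negbK => /eqP h.
have ne : f a != f b by apply: contra_neq ab => /f_inj.
apply/(line_span _ lM Ma Mb ne).
set d := f b - f a in h *.
have d0 : d != 0 by rewrite subr_eq0 eq_sym.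
by exists (dot d (f c - f a) / dot d d); rewrite -(cross_eq0 d0 h) addrC subrK.
Qed.

(* The component of [f c - f a] orthogonal to [f b - f a] is a functional
   constant on the line through [f a] and [f b] and larger at [f c]. *)
Lemma extremal_off_line a b c : noncollinear a b c ->
  exists2 v, extremal v & noncollinear a b v.
Proof.
move=> nc; pose d := f b - f a; pose e := f c - f a.
pose w := cross (cross d e) d.
have wE g : dot w g = dot (cross d e) (cross d g).
  by rewrite /w /dot !mxE /=; ring.
have [v ext_v v_max] := extremal_max w c.
exists v => //; apply/eqP => h.
have : 0 < dot w (f v - f a).
  apply: (@lt_le_trans _ _ (dot w e)); first by rewrite wE dotuu_gt0.
  by rewrite !dotB lerD2r.
by rewrite wE h /dot !mxE !mulr0 !addr0 ltxx.
Qed.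

Lemma is_line_through p q : p != q ->
  is_line [set p + t *: (q - p) | t in [set: R]]%classic.
Proof. by move=> pq; exists p, (q - p); rewrite subr_eq0 eq_sym. Qed.

(** [A] is any extremal point, [B] is furthest in the direction from [A] to another vertex, hence
    not [A], and [C] is taken off the line [A B]. *)
Lemma exists_noncollinear_extremal a b c : noncollinear a b c ->
  exists A B C, [/\ extremal A, extremal B, extremal C & noncollinear A B C].
Proof.
move=> nc; have [A extA _] := extremal_max 0 a.
have [v0 v0A] : exists v0, v0 != A.
  have [aA|] := eqVneq a A; last by exists a.
  exists b; rewrite -aA; apply: contra_neq nc => ->.
  by apply: row3P; rewrite !mxE /=; ring.
have [B extB B_max] := extremal_max (f v0 - f A) v0.
have AB : A != B.
  apply/eqP => E; have := B_max v0; rewrite -E -subr_le0 -dotB.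
  by rewrite leNgt dotuu_gt0 subr_eq0 (contra_neq (@f_inj _ _) v0A).
have fAB : f A != f B by apply: contra_neq AB => /f_inj.
pose M : set 'rV[R]_3 := [set f A + t *: (f B - f A) | t in [set: R]]%classic.
have lM : is_line M := is_line_through fAB.
have MA : M (f A) by exists 0 => //; rewrite scale0r addr0.
have MB : M (f B) by exists 1 => //; rewrite scale1r addrC subrK.
have [v ncv] : exists v, noncollinear A B v.
  apply: contrapT => /forallNP h; apply: (cross_line lM _ _ _ nc);
  by apply: cross0_line (h _).
have [C extC ncC] := extremal_off_line ncv.
by exists A, B, C.
Qed.

(** Both the maximum and the minimum of the functional are attained at extremal vertices. *)
Lemma extremal_const (w : 'rV[R]_3) (c : R) :
  (forall v, extremal v -> dot w (f v) = c) -> forall v, dot w (f v) = c.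
Proof.
move=> h v; apply/eqP; rewrite eq_le.
have [v1 /h v1E top] := extremal_max w v.
have [v2 /h v2E bot] := extremal_max (- w) v.
by rewrite -{1}v1E top -v2E; have := bot v; rewrite !dotNl lerN2.
Qed.

End Extremal.

(** * Polygons in the plane *)

Section Plane.
Variables (R : realType) (V : eqType) (X Y : V -> R).

Definition interp p q x : R := Y p + (Y q - Y p) / (X q - X p) * (x - X p).

Definition segments_meet p q u v : Prop := exists s t,
  [/\ 0 <= s <= 1, 0 <= t <= 1,
      (1 - s) * X p + s * X q = (1 - t) * X u + t * X v
    & (1 - s) * Y p + s * Y q = (1 - t) * Y u + t * Y v].

(* Does the upward vertical ray from [u] cross the edge [p q]?  The edge is
   half-open, so that no genericity of [u] is needed. *)
Definition ray_crosses u p q : bool :=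
  ((X p <= X u) (+) (X q <= X u)) && (Y u < interp p q (X u)).

(** The strip over [u v] is open on the left and closed on the right, opposite to the edge [p q] in
    [ray_crosses]; both tests thus use the same comparisons of a polygon vertex with [u] and [v]. *)
Definition above u v p : bool :=
  ((X p <= X u) (+) (X p <= X v)) && (interp u v (X p) < Y p).

Lemma interpC p q x : X p != X q -> interp p q x = interp q p x.
Proof.
move=> pq; rewrite /interp; field.
by rewrite !subr_eq0 pq eq_sym pq.
Qed.

Lemma interpl p q : interp p q (X p) = Y p.
Proof. by rewrite /interp subrr mulr0 addr0. Qed.

Lemma interpr p q : X p != X q -> interp p q (X q) = Y q.
Proof. by move=> pq; rewrite interpC // interpl. Qed.

Lemma segments_meetC1 p q u v : segments_meet q p u v -> segments_meet p q u v.
Proof.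
move=> [s [t [hs ht EX EY]]]; exists (1 - s), t; split=> //; first lra.
- by rewrite -EX; ring.
- by rewrite -EY; ring.
Qed.

Lemma segments_meetC2 p q u v : segments_meet p q v u -> segments_meet p q u v.
Proof.
move=> [s [t [hs ht EX EY]]]; exists s, (1 - t); split=> //; first lra.
- by rewrite EX; ring.
- by rewrite EY; ring.
Qed.

Lemma interp_eq_meet p q u v x : X p < X q -> X u < X v ->
  X p <= x <= X q -> X u <= x <= X v -> interp p q x = interp u v x ->
  segments_meet p q u v.
Proof.
move=> pq uv /andP[px xq] /andP[ux xv] E.
have pq0 : X q - X p != 0 by rewrite subr_eq0 gt_eqF.
have uv0 : X v - X u != 0 by rewrite subr_eq0 gt_eqF.
exists ((x - X p) / (X q - X p)), ((x - X u) / (X v - X u)); split.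
- by rewrite divr_ge0 ?ler_pdivrMr ?mul1r /= ?subr_ge0 ?subr_gt0 ?lerD2r // ltW.
- by rewrite divr_ge0 ?ler_pdivrMr ?mul1r /= ?subr_ge0 ?subr_gt0 ?lerD2r // ltW.
- by field; rewrite pq0 uv0.
- transitivity (interp p q x); first by rewrite /interp; field; exact: pq0.
  by rewrite E /interp; field; exact: uv0.
Qed.

(** The height difference of the two segments is affine in the abscissa; if it were positive at one
    place and not at another, it would vanish in between, at a common point. *)
Lemma no_meet_sign p q u v lo hi : X p < X q -> X u < X v ->
  ~ segments_meet p q u v ->
  X p <= lo <= X q -> X u <= lo <= X v -> X p <= hi <= X q -> X u <= hi <= X v ->
  (interp u v lo < interp p q lo) = (interp u v hi < interp p q hi).
Proof.
move=> pq uv nm plo ulo phi uhi.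
pose d x := interp p q x - interp u v x.
suff h x y : X p <= x <= X q -> X u <= x <= X v -> X p <= y <= X q ->
    X u <= y <= X v -> 0 < d x -> 0 < d y.
  rewrite -subr_gt0 -[RHS]subr_gt0; apply/idP/idP; exact: h.
move=> /andP[? ?] /andP[? ?] /andP[? ?] /andP[? ?] dx; rewrite ltNge; apply/negP => dy.
have D : d x - d y != 0 by rewrite gt_eqF //; lra.
(* [l] is chosen so that [d] vanishes at [(1 - l) * x + l * y]. *)
pose l := d x / (d x - d y).
have l0 : 0 <= l by rewrite divr_ge0 //; lra.
have l1 : 0 <= 1 - l by rewrite subr_ge0 ler_pdivrMr; lra.
apply: nm; apply: (@interp_eq_meet _ _ _ _ ((1 - l) * x + l * y)) => //.
- have ? : 0 <= (1 - l) * (x - X p) by rewrite mulr_ge0 // subr_ge0.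
  have ? : 0 <= l * (y - X p) by rewrite mulr_ge0 // subr_ge0.
  have ? : 0 <= (1 - l) * (X q - x) by rewrite mulr_ge0 // subr_ge0.
  have ? : 0 <= l * (X q - y) by rewrite mulr_ge0 // subr_ge0.
  by apply/andP; split; lra.
- have ? : 0 <= (1 - l) * (x - X u) by rewrite mulr_ge0 // subr_ge0.
  have ? : 0 <= l * (y - X u) by rewrite mulr_ge0 // subr_ge0.
  have ? : 0 <= (1 - l) * (X v - x) by rewrite mulr_ge0 // subr_ge0.
  have ? : 0 <= l * (X v - y) by rewrite mulr_ge0 // subr_ge0.
  by apply/andP; split; lra.
- apply/eqP; rewrite -subr_eq0 -/(d _); apply/eqP.
  transitivity ((1 - l) * d x + l * d y); first by rewrite /d /interp; ring.
  by rewrite /l; field; exact: D.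
Qed.

(* Both sides count the ends, within the common range of the two segments, at
   which the edge lies above [u v]. *)
Lemma ray_crosses_move p q u v : X p != X q -> X u != X v ->
  ~ segments_meet p q u v ->
  ray_crosses u p q (+) ray_crosses v p q = above u v p (+) above u v q.
Proof.
wlog pq : p q / X p < X q.
  move=> W pqN uvN nm; have [pq|qp|/eqP] := ltgtP (X p) (X q).
  - exact: W.
  - rewrite [RHS]addbC -W //.
      by rewrite /ray_crosses !(interpC _ pqN) (addbC (X p <= X u)) (addbC (X p <= X v)).
      by rewrite eq_sym.
    by move=> h; apply: nm; apply: segments_meetC1.
  - by rewrite (negPf pqN).
wlog uv : u v / X u < X v.
  move=> W pqN uvN nm; have [uv|vu|/eqP] := ltgtP (X u) (X v).
  - exact: W.
  - rewrite [LHS]addbC W //.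
      by rewrite /above !(interpC _ uvN) (addbC (X p <= X v)) (addbC (X q <= X v)).
      by rewrite eq_sym.
    by move=> h; apply: nm; apply: segments_meetC2.
  - by rewrite (negPf uvN).
move=> pqN uvN nm.
have S lo hi := @no_meet_sign p q u v lo hi pq uv nm.
rewrite /ray_crosses /above.
(* Four cases survive; the common range runs from [u] to [q], from [u] to [v], from [p] to [q] and
   from [p] to [v] respectively. *)
have [pu|up] := leP (X p) (X u); have [qu|uq] := leP (X q) (X u);
  have [pv|vp] := leP (X p) (X v); have [qv|vq] := leP (X q) (X v) => //=;
  try by exfalso; lra.
- have := S (X u) (X q); rewrite interpl (interpr pqN) => -> //=; try by apply/andP; split; lra.
  by rewrite addbF.
- have := S (X u) (X v); rewrite interpl (interpr uvN) => -> //=; try by apply/andP; split; lra.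
  by rewrite addbb.
- have := S (X p) (X q); rewrite interpl (interpr pqN) => -> //=; try by apply/andP; split; lra.
  by rewrite addbb.
- have := S (X p) (X v); rewrite interpl (interpr uvN) => -> //=; try by apply/andP; split; lra.
  by rewrite addbF.
Qed.

(** A parity, taken along an open path; a closed polygon is given by repeating its first vertex at
    the end. *)
Fixpoint path_crossings u (s : seq V) : bool :=
  if s is p :: s' then
    (if s' is q :: _ then ray_crosses u p q else false) (+) path_crossings u s'
  else false.

Lemma path_crossings_rcons u p s q :
  path_crossings u (rcons (p :: s) q) =
  path_crossings u (p :: s) (+) ray_crosses u (last p s) q.
Proof.
elim: s p => [|r s IH] p; first by rewrite /= !addbF.
by rewrite /= in IH *; rewrite IH addbA.
Qed.

Lemma leftmost_outside w s : injective X -> (forall v, X w <= X v) -> w \notin s ->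
  path_crossings w s = false.
Proof.
move=> X_inj w_min.
have far p : w != p -> (X p <= X w) = false.
  by move=> wp; apply/negbTE; rewrite -ltNge lt_neqAle w_min andbT (inj_eq X_inj).
elim: s => [//|p [//|q s] IH]; rewrite in_cons negb_or => /andP[wp ws].
rewrite /= -/(path_crossings w (q :: s)) (IH ws) addbF /ray_crosses far //.
by rewrite far //; move: ws; rewrite in_cons negb_or => /andP[].
Qed.

Lemma rightmost_outside w s : (forall v, X v <= X w) -> path_crossings w s = false.
Proof.
move=> w_max; elim: s => [//|p [//|q s] IH].
by rewrite /= -/(path_crossings w (q :: s)) IH addbF /ray_crosses !w_max.
Qed.

Lemma interp_le p q x y : X p <= x < X q -> Y p <= y -> Y q <= y -> interp p q x <= y.
Proof.
move=> /andP[px xq] py qy; have pq0 : 0 < X q - X p by lra.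
pose l := (x - X p) / (X q - X p).
have l0 : 0 <= l by rewrite divr_ge0 //; lra.
have l1 : 0 <= 1 - l by rewrite subr_ge0 ler_pdivrMr; lra.
have -> : interp p q x = (1 - l) * Y p + l * Y q.
  by rewrite /l /interp; field; rewrite gt_eqF.
have : (1 - l) * Y p <= (1 - l) * y by rewrite ler_wpM2l.
have : l * Y q <= l * y by rewrite ler_wpM2l.
lra.
Qed.

Lemma topmost_outside w s : (forall v, Y v <= Y w) -> path_crossings w s = false.
Proof.
move=> w_max; elim: s => [//|p [//|q s] IH].
rewrite /= -/(path_crossings w (q :: s)) IH addbF /ray_crosses.
have [pw|wp] := leP (X p) (X w); have [qw|wq] := leP (X q) (X w) => //=;
  apply/negbTE; rewrite -leNgt.
- by apply: interp_le; rewrite ?pw ?wq.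
- by rewrite interpC ?gt_eqF ?(le_lt_trans qw) //; apply: interp_le; rewrite ?qw ?wp.
Qed.

(** * Parity of ray crossings in a planar straight-line drawing *)

Section Drawing.
Variable e : rel V.
Hypothesis X_inj : injective X.
Hypothesis e_sym : symmetric e.
Hypothesis e_neq : forall p q, e p q -> p != q.
Hypothesis e_planar : forall p q u v, e p q -> e u v ->
  p != u -> p != v -> q != u -> q != v -> ~ segments_meet p q u v.

Lemma path_crossings_move u v p s : e u v -> path e p s ->
  u \notin p :: s -> v \notin p :: s ->
  path_crossings u (p :: s) (+) path_crossings v (p :: s) =
  above u v p (+) above u v (last p s).
Proof.
move=> uv; elim: s p => [|q s IH] p; first by rewrite /= addbb.
rewrite [path _ _ _]/= => /andP[pq qs]; rewrite in_cons negb_or => /andP[up us].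
rewrite in_cons negb_or => /andP[vp vs].
have E := IH q qs us vs.
have [uq vq] : u != q /\ v != q.
  by move: us vs; rewrite !in_cons !negb_or => /andP[? _] /andP[? _].
have M : ray_crosses u p q (+) ray_crosses v p q = above u v p (+) above u v q.
  apply: ray_crosses_move; rewrite ?(inj_eq X_inj) ?e_neq //.
  by apply: e_planar; rewrite // eq_sym.
rewrite [path_crossings u _]/= [path_crossings v _]/= [last p _]/=.
rewrite -/(path_crossings u (q :: s)) -/(path_crossings v (q :: s)) addbACA E M.
by rewrite addbA addbK.
Qed.

(** The slope is measured leftwards, so that among edges leaving a rightmost [a] a larger slope
    means a higher edge. *)
Definition slope a v := (Y v - Y a) / (X a - X v).

(* The edge to [n] leaves the rightmost vertex [a] of the polygon inside the
   angle between the polygon edges to [p] and to [last p t]. *)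
Lemma middle_inside a n p t : (forall v, X v <= X a) ->
  e a n -> e a p -> e (last p t) a -> path e p t ->
  a \notin p :: t -> n \notin p :: t ->
  slope a (last p t) < slope a n -> slope a n < slope a p ->
  path_crossings n (a :: rcons (p :: t) a) = true.
Proof.
move=> a_max an ap qa pt aN nN lt1 lt2; set q := last p t in qa lt1 *.
have X_lt v : a != v -> X v < X a.
  by move=> av; rewrite lt_neqAle a_max andbT (inj_eq X_inj) eq_sym.
have an' := X_lt _ (e_neq an); have ap' := X_lt _ (e_neq ap).
have aq' : X q < X a by apply: X_lt; rewrite eq_sym e_neq.
have Y_slope v : X v < X a -> Y v = Y a + slope a v * (X a - X v).
  by move=> va; rewrite /slope; field; rewrite subr_eq0 gt_eqF.
have interp_slope v x : X v < X a -> interp a v x = Y a + slope a v * (X a - x).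
  move=> va; rewrite /interp /slope; field.
  by rewrite !subr_eq0 gt_eqF ?lt_eqF.
have -> : path_crossings n (a :: rcons (p :: t) a) =
    ray_crosses n a p (+) path_crossings n (rcons (p :: t) a) by [].
rewrite path_crossings_rcons -/q.
(* Moving from [n] to [a], where the parity is 0, evaluates the open path from [p] to [q]; what
   remains concerns only the two polygon edges at [a] and reduces to comparing slopes. *)
have := path_crossings_move (_ : e n a) pt nN aN.
rewrite (rightmost_outside _ a_max) addbF -/q => ->; last by rewrite e_sym.
rewrite /ray_crosses /above !a_max (lt_geF an') /= !addbT addbF.
have flip v x : X v < X a -> interp v a x = interp a v x.
  by move=> va; rewrite interpC // lt_eqF.
rewrite !flip // !interp_slope // (Y_slope n) // (Y_slope p) // (Y_slope q) //.
rewrite !ltrD2l !ltr_pM2r ?subr_gt0 // lt2 (lt_gtF lt1) !andbF !andbT !addbF.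
by case: (X p <= X n).
Qed.

(** Off the polygon, [b] would be outside while [n] is inside; yet the parity is constant along
    edges off the polygon, hence by the connectivity hypothesis on all vertices off it. *)
Lemma extremes_on_polygon a n p t b : (forall v, X v <= X a) ->
  e a n -> e a p -> e (last p t) a -> path e p t ->
  a \notin p :: t -> n \notin p :: t ->
  slope a (last p t) < slope a n -> slope a n < slope a p ->
  (forall g : V -> bool,
     (forall u v, e u v -> u \notin a :: p :: t -> v \notin a :: p :: t -> g u = g v) ->
     forall u v, u \notin a :: p :: t -> v \notin a :: p :: t -> g u = g v) ->
  (forall v, X b <= X v) \/ (forall v, Y v <= Y b) -> b \in a :: p :: t.
Proof.
move=> a_max an ap qa pt aN nN lt1 lt2 conn ext; apply/negPn/negP => bN.
have inC v : (v \in a :: rcons (p :: t) a) = (v \in a :: p :: t).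
  by rewrite in_cons mem_rcons !in_cons; case: (v == a).
have bout : path_crossings b (a :: rcons (p :: t) a) = false.
  by case: ext => ext; [apply: leftmost_outside; rewrite ?inC|apply: topmost_outside].
have closed : path e a (rcons (p :: t) a) by rewrite rcons_path /= ap pt.
suff : path_crossings n (a :: rcons (p :: t) a) = path_crossings b (a :: rcons (p :: t) a).
  by rewrite bout middle_inside.
apply: (conn (fun v => path_crossings v (a :: rcons (p :: t) a))) bN => [u v uv uN vN|].
- have := path_crossings_move uv closed; rewrite !inC last_rcons addbb => /(_ uN vN).
  by case: path_crossings; case: path_crossings.
- by rewrite in_cons negb_or nN andbT eq_sym e_neq.
Qed.

End Drawing.

End Plane.

(** Connectedness of the graph without [s], phrased through Boolean functions so that it applies
    directly to the parity of crossings. *)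
Definition off_connected (G : sgraph) (s : seq G) : Prop :=
  forall g : G -> bool,
    (forall u v, adj u v -> u \notin s -> v \notin s -> g u = g v) ->
    forall u v, u \notin s -> v \notin s -> g u = g v.

(* Every angle at a vertex is spanned by a cycle that avoids the other
   neighbours, does not separate the graph, and whose triples satisfy [Q]. *)
Definition opposite_cycles (G : sgraph) (Q : G -> G -> G -> Prop) : Prop :=
  forall a n p q : G, adj a n -> adj a p -> adj a q -> n != p -> n != q -> p != q ->
  exists t : seq G,
  [/\ last p t = q, path (@adj G) p t, a \notin p :: t & n \notin p :: t] /\
  (off_connected (a :: p :: t) /\
   (forall x y z, x \in a :: p :: t -> y \in a :: p :: t -> z \in a :: p :: t ->
      x != y -> x != z -> y != z -> Q x y z)).

(* Three sets [SA], [SB], [SC] of three lines each cannot pairwise cross in nine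
   common points: a point of maximal [p * q] would be alone on its line of [SC]. *)
Lemma no_multiplicative_net (R : realType) (T K : finType) (I : {set T})
    (SA SB SC : {set K}) (ia ib ic : T -> K) (p q : T -> R) :
  #|I| = 9 -> #|SA| = 3 -> #|SB| = 3 -> #|SC| = 3 ->
  {in I, forall X, [/\ ia X \in SA, ib X \in SB & ic X \in SC]} ->
  {in I &, forall X Y, ia X = ia Y -> ib X = ib Y -> X = Y} ->
  {in I &, forall X Y, ia X = ia Y -> ic X = ic Y -> X = Y} ->
  {in I, forall X, 0 < p X /\ 0 < q X} ->
  {in I &, forall X Y, ia X = ia Y -> p X = p Y} ->
  {in I &, forall X Y, ib X = ib Y -> q X = q Y} ->
  {in I &, forall X Y, ic X = ic Y -> p X * q X = p Y * q Y} ->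
  {in I &, forall X Y, p X = p Y -> q X = q Y -> X = Y} -> False.
Proof.
move=> I9 A3 B3 C3 inS inj_ab inj_ac pos pA qB rC pq_inj.
have meet a b : a \in SA -> b \in SB -> exists X, [/\ X \in I, ia X = a & ib X = b].
  move=> aS bS; suff /imsetP[X XI [-> ->]] : (a, b) \in [set (ia X, ib X) | X in I].
    by exists X.
  (* Nine points inject into nine pairs of lines, so every pair is met. *)
  have /eqP -> : [set (ia X, ib X) | X in I] == finset.setX SA SB; last first.
    by rewrite finset.in_setX aS bS.
  rewrite eqEcard cardsX A3 B3 card_in_imset ?I9 ?andbT.
    by apply/fintype.subsetP => _ /imsetP[X /inS[aX bX _] ->]; rewrite finset.in_setX aX bX.
  by move=> X Y XI YI [? ?]; apply: inj_ab.
have [X1 X1I] : exists X1, X1 \in I by apply/card_gt0P; rewrite I9.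
have [X0 [X0I r_max]] := @exists_max R T [in I] (fun X => p X * q X) X1 X1I.
(* If [X] had the larger [p], the point combining the [p] of [X] with the [q] of [X0] would beat the
   maximum; if it had the smaller [p], exchange the roles. *)
have alone X : X \in I -> ic X = ic X0 -> X = X0.
  move=> XI cX; have r_eq := rC _ _ XI X0I cX.
  have [pX qX] := pos X XI; have [pX0 qX0] := pos X0 X0I.
  have [aX bX _] := inS X XI; have [aX0 bX0 _] := inS X0 X0I.
  have [lt|lt|E] := ltgtP (p X) (p X0); last first.
  - by apply: pq_inj => //; apply: (mulfI (lt0r_neq0 pX)); rewrite r_eq E.
  - have [Y [YI aY bY]] := meet (ia X) (ib X0) aX bX0.
    have := r_max Y YI; rewrite (pA Y X) // (qB Y X0) //.
    by rewrite ler_pM2r // leNgt lt.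
  - have [Y [YI aY bY]] := meet (ia X0) (ib X) aX0 bX.
    have := r_max Y YI; rewrite (pA Y X0) // (qB Y X) // -r_eq.
    by rewrite ler_pM2r // leNgt lt.
have [_ _ cX0] := inS X0 X0I.
(* The other eight points would inject into the pairs formed by the two other lines of [SC] and
   three lines of [SA], of which there are six. *)
have : (#|[set (ic X, ia X) | X in I :\ X0]| <= #|finset.setX (SC :\ ic X0) SA|)%N.
  apply: subset_leq_card; apply/fintype.subsetP => y /imsetP[X].
  rewrite in_setD1 => /andP[X_X0 XI] ->; have [aX _ cX] := inS X XI.
  rewrite finset.in_setX in_setD1 aX cX !andbT.
  by apply: contra_neq X_X0; apply: alone.
have cI : #|I :\ X0| = 8 by have := cardsD1 X0 I; rewrite X0I I9 => -[].
have cC : #|SC :\ ic X0| = 2%N by have := cardsD1 (ic X0) SC; rewrite cX0 C3 => -[].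
rewrite cardsX A3 cC card_in_imset ?cI // => X Y.
by rewrite !in_setD1 => /andP[_ XI] /andP[_ YI] [? ?]; apply: inj_ac.
Qed.

(** * Drawings on few lines *)

Section Arrangement.
Variables (R : realType) (G : sgraph) (f : G -> 'rV[R]_3).
Variables (k : nat) (L : 'I_k -> set 'rV[R]_3).
Hypothesis f_cf : crossing_free f.
Hypothesis L_line : forall i, is_line (L i).
Hypothesis f_cover : (drawn_set f `<=` \bigcup_(i in [set: 'I_k]) L i)%classic.

Let f_inj : injective f. Proof. by case: f_cf. Qed.

Let f_neq u v : u != v -> f u != f v.
Proof. by apply: contra_neq => /f_inj. Qed.

Lemma adj_neq (u v : G) : adj u v -> u != v.
Proof. by apply: contraTneq => ->; rewrite adj_irr. Qed.

Lemma not_between_adj (u v w : G) : adj u w -> v != u -> v != w ->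
  ~ strictly_between (f u) (f v) (f w).
Proof.
case: f_cf => _ h _ uw /eqP vu /eqP vw [t /andP[t0 t1] E].
have [] // := h u w v uw.
by exists t; rewrite /= ?in_itv /= ?ltW.
Qed.

(* Repeated lines are counted once, under their least index. *)
Definition inc (v : G) : {set 'I_k} :=
  locked [set i | `[< L i (f v) /\ forall j : 'I_k, (j < i)%N -> L j <> L i >]].

Lemma incP i v :
  reflect (L i (f v) /\ forall j : 'I_k, (j < i)%N -> L j <> L i) (i \in inc v).
Proof. by rewrite /inc -lock finset.inE; apply: asboolP. Qed.

Lemma inc_on i v : i \in inc v -> L i (f v).
Proof. by case/incP. Qed.

Lemma inc_eq u v i j : u != v ->
  i \in inc u -> i \in inc v -> j \in inc u -> j \in inc v -> i = j.
Proof.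
move=> uv iu iv ju jv.
have E : L i = L j.
  exact: (line_eq (L_line i) (L_line j) (f_neq uv)
    (inc_on iu) (inc_on iv) (inc_on ju) (inc_on jv)).
have [[_ hi] [_ hj]] := (incP _ _ iu, incP _ _ ju).
case: (ssrnat.ltngtP i j) => [/hj []|/hi []|/val_inj //]; rewrite E //.
Qed.

Lemma inc_meet u v : u != v -> (#|inc u :&: inc v| <= 1)%N.
Proof.
move=> uv; apply/card_le1_eqP => i j; rewrite !finset.inE.
by move=> /andP[iu iv] /andP[ju jv]; exact: (inc_eq uv ju jv iu iv).
Qed.

Lemma inc_of_line i u v : L i (f u) -> L i (f v) ->
  exists2 j, j \in inc u & j \in inc v.
Proof.
move=> iu iv.
have [j /asboolP Ej min_j] := @arg_minnP _ i (fun j => `[< L j = L i >]) val (asboolT erefl).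
have hj (j' : 'I_k) : (j' < j)%N -> L j' <> L j.
  rewrite ltnNge => /negP h E; apply: h; apply: min_j.
  by apply/asboolP; rewrite E.
by exists j; apply/incP; rewrite Ej; split=> // j' /hj; rewrite Ej.
Qed.

(* The edge carries [k + 1] points, two of which lie on the same line. *)
Lemma adj_inc u v : adj u v -> exists2 i, i \in inc u & i \in inc v.
Proof.
move=> uv; have uvN := adj_neq uv.
pose t (j : 'I_k.+1) : R := j%:R / k.+1%:R.
pose p j : 'rV[R]_3 := (1 - t j) *: f u + t j *: f v.
have t_inj : injective t.
  move=> a b /(mulIf _) h; apply: val_inj; apply/eqP.
  by rewrite -(eqr_nat R) h // invr_eq0 pnatr_eq0.
have Lp j : exists i, L i (p j).
  have [|i _] := @f_cover (p j); last by exists i.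
  right; exists u, v; split=> //; exists (t j) => //=.
  rewrite in_itv /= divr_ge0 ?ler0n //= ler_pdivrMr ?ltr0n // mul1r ler_nat.
  exact/ltnW/ltn_ord.
have [g gP] := choice Lp.
have [j [j' [jj' E]]] : exists j j', j != j' /\ g j = g j'.
  apply: contrapT => h; suff /leq_card : injective g by rewrite !card_ord ltnn.
  move=> j j' E; apply/eqP; apply: contrapT => /negP jj'.
  by apply: h; exists j, j'.
have tt : t j' - t j != 0 by rewrite subr_eq0 eq_sym (contra_neq (@t_inj _ _) jj').
have pp : p j != p j'.
  apply: contra_neq (f_neq uvN) => Ep; apply/eqP; rewrite -subr_eq0; apply/eqP.
  apply: (scalerI tt); rewrite scaler0.
  have -> : (t j' - t j) *: (f u - f v) = p j - p j'.
    by apply: row3P; rewrite /p !mxE; ring.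
  by rewrite Ep subrr.
have gp' := gP j'; rewrite -E in gp'.
apply: (inc_of_line (i := g j)); apply/(line_span _ _ (gP j) gp' pp) => //.
- by exists (- t j / (t j' - t j)); apply: row3P; rewrite /p !mxE; field; exact: tt.
- by exists ((1 - t j) / (t j' - t j)); apply: row3P; rewrite /p !mxE; field; exact: tt.
Qed.

(** Neither edge passes through the end of the other, so of the three collinear points only [v] can
    be in the middle. *)
Lemma nbr_between i v u w : adj v u -> adj v w -> u != w ->
  i \in inc v -> i \in inc u -> i \in inc w ->
  strictly_between (f u) (f v) (f w).
Proof.
move=> vu vw uw /inc_on iv /inc_on iu /inc_on iw.
have [vuN vwN] := (adj_neq vu, adj_neq vw).
have [|h|h] // := line_trichotomy (L_line i) iv iu iw
  (f_neq vuN) (f_neq vwN) (f_neq uw).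
- by case: (not_between_adj vw _ uw h); rewrite eq_sym.
- by case: (not_between_adj vu _ _ h); rewrite // eq_sym.
Qed.

Definition nbrs (v : G) : {set G} := [set u | adj v u].

Lemma line_nbrs_extremal i v : extremal f v -> i \in inc v ->
  (#|[set u in nbrs v | i \in inc u]| <= 1)%N.
Proof.
move=> ext iv; apply/card_le1_eqP => u w; rewrite !finset.inE.
move=> /andP[vu iu] /andP[vw iw]; apply/eqP; rewrite eq_sym.
apply: contrapT => /negP uw.
by move: (uw); rewrite (ext u w (nbr_between vu vw uw iv iu iw)) eqxx.
Qed.

Lemma line_nbrs i v : i \in inc v -> (#|[set u in nbrs v | i \in inc u]| <= 2)%N.
Proof.
move=> iv; rewrite leqNgt; apply/negP => /card_gt2P[x [y [z [[]]]]].
rewrite !finset.inE => /andP[vx ix] /andP[vy iy] /andP[vz iz] [xy yz zx].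
have [s /andP[s0 s1] Es] := nbr_between vx vy xy iv ix iy.
have [t /andP[t0 t1] Et] := nbr_between vy vz yz iv iy iz.
have [r /andP[r0 r1] Er] := nbr_between vz vx zx iv iz ix.
pose a := f x - f v; pose b := f y - f v; pose c := f z - f v.
have Ea : (1 - s) *: a + s *: b = 0.
  by rewrite /a /b {1 2}Es; apply: row3P; rewrite !mxE; ring.
have Eb : (1 - t) *: b + t *: c = 0.
  by rewrite /b /c {1 2}Et; apply: row3P; rewrite !mxE; ring.
have Ec : (1 - r) *: c + r *: a = 0.
  by rewrite /a /c {1 2}Er; apply: row3P; rewrite !mxE; ring.
(* Three neighbours would lie pairwise on opposite sides of [v]; eliminating [b] and [c] leaves a
   positive multiple of [a]. *)
have a0 : ((1 - r) * (1 - t) * (1 - s) + r * t * s) *: a = 0.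
  transitivity ((1 - r) * (1 - t) *: ((1 - s) *: a + s *: b)
    - (1 - r) * s *: ((1 - t) *: b + t *: c) + t * s *: ((1 - r) *: c + r *: a)).
    by apply: row3P; rewrite !mxE; ring.
  by rewrite Ea Eb Ec !scaler0 subrr add0r.
move/eqP: a0; rewrite scaler_eq0 subr_eq0 (eq_sym (f x)) (negPf (f_neq (adj_neq vx))) orbF.
by rewrite gt_eqF // addr_gt0 // ?mulr_gt0 // subr_gt0.
Qed.

(** Double counting: each neighbour of [v] shares a line with it, and each line takes at most [m]
    neighbours. *)
Lemma inc_bound v m : (forall i, i \in inc v -> (#|[set u in nbrs v | i \in inc u]| <= m)%N) ->
  (#|nbrs v| <= m * #|inc v|)%N.
Proof.
move=> h.
rewrite -sum1_card.
apply: (@leq_trans (\sum_(u in nbrs v) \sum_(i in inc v) (i \in inc u))%N).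
  apply: leq_sum => u; rewrite finset.inE => /adj_inc[i iv iu].
  by rewrite (bigD1 i) //= iu.
rewrite exchange_big /= mulnC -sum_nat_const; apply: leq_sum => i iv.
apply: leq_trans (h i iv); rewrite -sum1_card big_mkcond [leqRHS]big_mkcond /=.
by apply: leq_sum => u _; rewrite !finset.inE; case: (adj v u); case: (i \in inc u).
Qed.

Lemma inc_ge_extremal v : extremal f v -> (#|nbrs v| <= #|inc v|)%N.
Proof.
by move=> ext; rewrite -[leqRHS]mul1n; apply: inc_bound => i; apply: line_nbrs_extremal.
Qed.

Lemma inc_ge v : (#|nbrs v| <= 2 * #|inc v|)%N.
Proof. by apply: inc_bound => i; apply: line_nbrs. Qed.

Lemma inc_closed i u v : i \in inc u -> L i (f v) -> i \in inc v.
Proof. by case/incP => _ i_min iv; apply/incP. Qed.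

Lemma inc_noncollinear i a b c : i \in inc a -> i \in inc b -> i \in inc c ->
  ~ noncollinear f a b c.
Proof. by move=> /inc_on ia /inc_on ib /inc_on ic; apply: (cross_line (L_line i)). Qed.

Lemma noncollinear_nbrs v : (2 < #|nbrs v|)%N ->
  exists x y, [/\ adj v x, adj v y & noncollinear f v x y].
Proof.
case/card_gt2P => x [y [z [[]]]]; rewrite !finset.inE => vx vy vz [xy yz zx].
have [i iv ix] := adj_inc vx.
have col w : ~ noncollinear f v x w -> i \in inc w.
  move=> nc; apply: (inc_closed iv).
  exact: (cross0_line f_inj (L_line i) (inc_on iv) (inc_on ix) (adj_neq vx) nc).
case: (pselect (noncollinear f v x y)) => [|/col iy]; first by exists x, y.
case: (pselect (noncollinear f v x z)) => [|/col iz]; first by exists x, z.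
have := line_nbrs iv; rewrite leqNgt => /negP[].
by apply/card_gt2P; exists x, y, z; rewrite !finset.inE vx vy vz ix iy iz.
Qed.

(** Two vertices share at most one line, so each pair of lines is counted at no more than one
    vertex. *)
Lemma sum_pairs_le (B : G -> {set 'I_k}) (S : {set {set 'I_k}}) :
  (forall v, B v \subset inc v) ->
  (forall v (A : {set 'I_k}), A \subset B v -> #|A| = 2 -> A \in S) ->
  (\sum_v 'C(#|B v|, 2) <= #|S|)%N.
Proof.
move=> B_inc B_S.
have -> : (\sum_v 'C(#|B v|, 2) =
    \sum_v \sum_(A in S) ((A \subset B v) && (#|A| == 2)))%N.
  apply: eq_bigr => v _; rewrite -cards_draws -sum1_card [LHS]big_mkcond [RHS]big_mkcond /=.
  apply: eq_bigr => A _; rewrite finset.inE.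
  case: (boolP (_ && _)) => [/andP[AB /eqP A2]|_]; first by rewrite (B_S v).
  by case: (A \in S).
rewrite exchange_big -sum1_card; apply: leq_sum => A _ /=.
case: (boolP (#|A| == 2)) => [/eqP A2|_]; last first.
  by rewrite big1 // => v _; rewrite andbF.
case: (pickP (fun v => A \subset B v)) => [v AB|none]; last first.
  by rewrite big1 // => v _; rewrite none.
rewrite (bigD1 v) //= big1 ?addn0 ?leq_b1 // => u uv; rewrite andbT.
apply/eqP; rewrite eqb0; apply/negP => AB'.
have : (#|A| <= #|inc u :&: inc v|)%N.
  by rewrite subset_leq_card // finset.subsetI !(fintype.subset_trans _ (B_inc _)).
by rewrite A2 => /leq_trans/(_ (inc_meet uv)).
Qed.

Lemma sum_pairs_off (D : {set 'I_k}) :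
  (\sum_v 'C(#|inc v :\: D|, 2) <= 'C(k - #|D|, 2))%N.
Proof.
have -> : (k - #|D| = #|~: D|)%N by have := cardsC D; rewrite card_ord; lia.
rewrite -cards_draws; apply: sum_pairs_le => [v|v A]; first exact: finset.subsetDl.
by rewrite finset.inE finset.setDE finset.subsetI => /andP[_ ->] ->.
Qed.

(* Were [i] and [j] not to meet at a vertex, their pair would not be counted. *)
Lemma pairs_tight_meet i j : ('C(k, 2) <= \sum_v 'C(#|inc v|, 2))%N -> i != j ->
  exists v, i \in inc v /\ j \in inc v.
Proof.
move=> tight ij; apply: contrapT => /forallNP no.
pose S := [set A : {set 'I_k} | A \subset [set: 'I_k] & #|A| == 2].
have ijS : [set i; j]%SET \in S by rewrite finset.inE finset.subsetT cards2 ij.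
have := @sum_pairs_le inc (S :\ [set i; j]%SET) (fun v => subxx _).
have := cardsD1 [set i; j]%SET S; rewrite ijS cards_draws cardsT card_ord => cE h.
have : (\sum_v 'C(#|inc v|, 2) <= #|S :\ [set i; j]%SET|)%N.
  apply: h => v A Av A2; rewrite !finset.inE finset.subsetT A2 eqxx /= andbT.
  apply/eqP => AE; apply: (no v); split; apply: (fintype.subsetP Av);
  by rewrite AE !finset.inE eqxx ?orbT.
by move=> /(leq_trans tight); rewrite cE ltnn.
Qed.

Lemma card_inc2 A B : A != B ->
  (#|inc A| + #|inc B| <= #|inc A :|: inc B| + 1)%N.
Proof. by move=> AB; rewrite -cardsUI leq_add2l inc_meet. Qed.

Lemma card_inc3 A B C : A != B -> A != C -> B != C ->
  (#|inc A| + #|inc B| + #|inc C| <= #|inc A :|: inc B :|: inc C| + 3)%N.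
Proof.
move=> AB AC BC.
have h2 := card_inc2 AB; have hU := cardsUI (inc A :|: inc B) (inc C).
have hI : (#|(inc A :|: inc B) :&: inc C| <= 2)%N.
  rewrite finset.setIUl; apply: leq_trans (leq_card_setU _ _) _.
  by rewrite (leq_add (inc_meet AC) (inc_meet BC)).
lia.
Qed.

Lemma card_inc4 A B C D : A != B -> A != C -> B != C -> A != D -> B != D -> C != D ->
  (#|inc A| + #|inc B| + #|inc C| + #|inc D| <= k + 6)%N.
Proof.
move=> AB AC BC AD BD CD.
have h3 := card_inc3 AB AC BC; have hU := cardsUI (inc A :|: inc B :|: inc C) (inc D).
have hI : (#|(inc A :|: inc B :|: inc C) :&: inc D| <= 3)%N.
  rewrite !finset.setIUl; apply: leq_trans (leq_card_setU _ _) _.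
  apply: leq_trans (leq_add (leq_card_setU _ _) (leqnn _)) _.
  by rewrite (leq_add (leq_add (inc_meet AD) (inc_meet BD)) (inc_meet CD)).
have hk := subset_leq_card (finset.subsetT (inc A :|: inc B :|: inc C :|: inc D)).
rewrite cardsT card_ord in hk.
lia.
Qed.

Lemma noncollinear_neq a b c : noncollinear f a b c -> [/\ a != b, a != c & b != c].
Proof.
move=> nc; split; apply: contra_neq nc => ->; apply: row3P; rewrite !mxE /=; ring.
Qed.

Lemma regular_lower_bound d : (2 < d)%N -> (0 < #|G|)%N ->
  (forall v, #|nbrs v| = d) -> (3 * d - 3 <= k)%N.
Proof.
move=> d2 /card_gt0P[v0 _] deg.
have [] := @noncollinear_nbrs v0; rewrite ?deg // => x [y [_ _ nc]].
have [A [B [C [eA eB eC /noncollinear_neq[AB AC BC]]]]] :=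
  exists_noncollinear_extremal f_inj nc.
have := inc_ge_extremal eA; have := inc_ge_extremal eB; have := inc_ge_extremal eC.
have h3 := card_inc3 AB AC BC; have := subset_leq_card (finset.subsetT (inc A :|: inc B :|: inc C)).
rewrite cardsT card_ord !deg => hk hC hB hA; lia.
Qed.

(** A third vertex on the line would lie inside the edge [A B], or would put [A] or [B] strictly
    between two vertices. *)
Lemma adj_extremals_line A B i v : extremal f A -> extremal f B -> adj A B ->
  i \in inc A -> i \in inc B -> i \in inc v -> v = A \/ v = B.
Proof.
move=> eA eB AB /inc_on iA /inc_on iB /inc_on iv.
have [->|vA] := eqVneq v A; first by left.
have [->|vB] := eqVneq v B; first by right.
rewrite eq_sym in vA; rewrite eq_sym in vB; have ABN := adj_neq AB.
have [/eA E|/eB E|h] := line_trichotomy (L_line i) iA iB iv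
  (f_neq ABN) (f_neq vA) (f_neq vB).
- by rewrite E eqxx in vB.
- by rewrite E eqxx in vA.
- by case: (not_between_adj AB _ _ h); rewrite // eq_sym.
Qed.

(** * Coplanar drawings *)

Definition coplanar a b c : Prop := noncollinear f a b c /\
  forall v, dot (cross (f b - f a) (f c - f a)) (f v - f a) = 0.

Lemma coplanar_extremals a b c : noncollinear f a b c ->
  (forall v, extremal f v -> [\/ v = a, v = b | v = c]) -> coplanar a b c.
Proof.
move=> nc ext; split=> // v; set w := cross _ _.
rewrite dotB; apply/eqP; rewrite subr_eq0; apply/eqP.
apply: (extremal_const f_inj) => {}v /ext[] -> //; apply/eqP; rewrite -subr_eq0 -dotB.
- by apply/eqP; rewrite /w /dot !mxE /=; ring.
- by apply/eqP; rewrite /w /dot !mxE /=; ring.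
Qed.

Lemma dot_line i (w : 'rV[R]_3) x y z : x != y ->
  i \in inc x -> i \in inc y -> i \in inc z ->
  dot w (f x) = dot w (f y) -> dot w (f z) = dot w (f x).
Proof.
move=> xy /inc_on ix /inc_on iy /inc_on iz E.
have [s ->] := (line_span (f z) (L_line i) ix iy (f_neq xy)).1 iz.
by rewrite dotD dotZ dotB E subrr mulr0 addr0.
Qed.

(** A vertex [u] other than [v] has a line avoiding [v]. It meets the lines of [v x] and [v y] at
    distinct vertices of the plane, so [u] is in the plane too. *)
Lemma meet_coplanar v x y : adj v x -> adj v y -> noncollinear f v x y ->
  (forall u, 2 <= #|inc u|)%N ->
  (forall i j, i != j -> exists u, i \in inc u /\ j \in inc u) -> coplanar v x y.
Proof.
move=> vx vy nc inc2 meet; split=> // u; set w := cross _ _.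
have [i iv ix] := adj_inc vx; have [j jv jy] := adj_inc vy.
have ij : i != j.
  by apply/eqP => E; apply: (inc_noncollinear iv ix _ nc); rewrite E.
have wx : dot w (f v) = dot w (f x).
  by apply/eqP; rewrite eq_sym -subr_eq0 -dotB /w /dot !mxE /=; apply/eqP; ring.
have wy : dot w (f v) = dot w (f y).
  by apply/eqP; rewrite eq_sym -subr_eq0 -dotB /w /dot !mxE /=; apply/eqP; ring.
rewrite dotB; apply/eqP; rewrite subr_eq0; apply/eqP.
have [->//|uv] := eqVneq u v.
have [l lu lv] : exists2 l, l \in inc u & l \notin inc v.
  apply: contrapT => /forall2NP h; have := inc2 u; rewrite leqNgt => /negP[].
  rewrite ltnS; apply: leq_trans (inc_meet uv); rewrite subset_leq_card // finset.subsetI subxx /=.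
  apply/fintype.subsetP => l lu; case: (h l) => // /negP; by rewrite negbK.
have li : l != i by apply: contraNneq lv => ->.
have lj : l != j by apply: contraNneq lv => ->.
have [p [lp ip]] := meet l i li; have [q [lq jq]] := meet l j lj.
have wp : dot w (f p) = dot w (f v) by apply: (dot_line (adj_neq vx) iv ix ip).
have wq : dot w (f q) = dot w (f v) by apply: (dot_line (adj_neq vy) jv jy jq).
have pq : p != q.
  apply: contra_neq ij => pq; rewrite -pq in jq.
  apply: (@inc_eq p v) => //; apply: contraNneq lv => <-; exact: lp.
by rewrite -wp; apply: (dot_line pq lp lq lu); rewrite wp wq.
Qed.

Lemma generic_combination (F H : G -> R) :
  (forall u v, F u = F v -> H u = H v -> u = v) ->
  exists l, injective (fun v => F v + l * H v).
Proof.
move=> FH.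
(* [l] exceeds every ratio at which two of the values could coincide. *)
pose l := 1 + \sum_(p : G * G) `|(F p.1 - F p.2) / (H p.2 - H p.1)|.
exists l => u v E.
have [Huv|Huv] := eqVneq (H u) (H v).
  by apply: FH => //; move: E; rewrite Huv => /addIr.
have D : H v - H u != 0 by rewrite subr_eq0 eq_sym.
have lE : l = (F u - F v) / (H v - H u).
  by apply: (mulIf D); rewrite divfK //; lra.
have : `|(F u - F v) / (H v - H u)| <= l - 1.
  rewrite /l addrAC subrr add0r (bigD1 (u, v)) //= lerDl.
  by apply: sumr_ge0.
by rewrite -lE => /(le_trans (ler_norm _)); rewrite lerDl oppr_ge0 ler10.
Qed.

(** [X] is a generic coordinate with extremes [A] and [B]. [Y] is constant on the line [A B] and
    signed so that some vertex is higher; hence the topmost [C] differs from both. *)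
Lemma planar_frame a b c : coplanar a b c ->
  exists (X Y : G -> R) (A B C : G),
  [/\ injective X,
      forall p q u v, segments_meet X Y p q u v ->
        exists2 m, segment (f p) (f q) m & segment (f u) (f v) m,
      [/\ extremal f A, extremal f B & extremal f C],
      [/\ A != B, A != C & B != C]
    & [/\ forall v, X v <= X A, forall v, X B <= X v & forall v, Y v <= Y C]].
Proof.
move=> [nc flat].
have [y [z [y1 y0 z0 z1 yz]]] := plane_coordinates nc.
pose F v := dot y (f v - f a); pose H v := dot z (f v - f a).
have fE v : f v - f a = F v *: (f b - f a) + H v *: (f c - f a) by apply/yz/flat.
have [u v Fuv Huv|l X_inj] := @generic_combination F H.
  by apply/f_inj/(addIr (- f a)); rewrite (fE u) (fE v) Fuv Huv.
set X := fun v => _ in X_inj; pose x := y + l *: z.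
have XE v : X v = dot x (f v) - dot x (f a).
  by rewrite /X /F /H -!dotB /x dotDl dotZl.
have [A eA A_max] := extremal_max f_inj x a.
have [B eB B_min] := extremal_max f_inj (- x) a.
have XA v : X v <= X A by rewrite !XE lerD2r.
have XB v : X B <= X v.
  by rewrite !XE lerD2r; have := B_min v; rewrite !dotNl lerN2.
have [ab ac bc] := noncollinear_neq nc.
have AB : A != B.
  apply: contra_neq ab => E; apply: X_inj; rewrite -E in XB.
  by apply: le_anti; rewrite (le_trans (XA a) (XB b)) (le_trans (XA b) (XB a)).
have XAB : X B < X A by rewrite lt_neqAle XB (inj_eq X_inj) eq_sym AB.
pose w := (X A - X B) *: z - (H A - H B) *: x.
have wE v : dot w (f v - f a) = (X A - X B) * H v - (H A - H B) * X v.
  by rewrite /w dotDl dotNl !dotZl (XE v) -dotB.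
have wAB : dot w (f A) = dot w (f B).
  by apply: (addIr (- dot w (f a))); rewrite -!dotB !wE; ring.
have [s [s2 [v0 v0A]]] : exists s : R, s * s = 1 /\
    exists v0, dot (s *: w) (f A) < dot (s *: w) (f v0).
  have [v0 v0A] : exists v0, dot w (f v0) != dot w (f A).
    apply: contrapT => /forallNP h.
    have {}h v : (X A - X B) * H v - (H A - H B) * X v
        = (X A - X B) * H A - (H A - H B) * X A.
      rewrite -!wE !dotB; congr (_ - _); apply/eqP/negPn/negP => hv.
      by apply: (h v).
    (* In the coordinates [F], [H] the points [a], [b], [c] are (0, 0), (1, 0), (0, 1); constancy
       there forces [H A = H B], and then [X A = X B]. *)
    have [Fa Ha] : F a = 0 /\ H a = 0 by rewrite /F /H subrr /dot !mxE !mulr0 !addr0.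
    have hb := h b; have hc := h c; have ha := h a; move: ha hb hc.
    rewrite /X -/(X A) -/(X B) Fa Ha [F b]y1 [F c]y0 [H b]z0 [H c]z1 => ha hb hc.
    have HAB : H A - H B = 0 by lra.
    by move: hc ha; rewrite HAB; lra.
  case: (ltgtP (dot w (f v0)) (dot w (f A))) v0A => // lt _.
    by exists (-1); split; [ring|exists v0; rewrite !dotZl !mulN1r ltrN2].
  by exists 1; split; [ring|exists v0; rewrite !scale1r].
have s0 : s != 0.
  by apply/eqP => s0; move/eqP: s2; rewrite s0 mul0r eq_sym oner_eq0.
have [C eC C_max] := extremal_max f_inj (s *: w) v0.
have CA : dot (s *: w) (f A) < dot (s *: w) (f C) by apply: lt_le_trans (C_max v0).
exists X, (fun v => dot (s *: w) (f v)), A, B, C; split=> //.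
- move=> p q u v [t [t' [ht ht' EX EY]]].
  exists ((1 - t) *: f p + t *: f q); first by exists t; rewrite /= ?in_itv.
  exists t'; first by rewrite /= in_itv.
  have comb m m' r : (1 - r) *: f m + r *: f m' = f a +
      (((1 - r) * F m + r * F m') *: (f b - f a) +
       ((1 - r) * H m + r * H m') *: (f c - f a)).
    rewrite -[f m](subrK (f a)) -[f m'](subrK (f a)) (fE m) (fE m').
    by apply: row3P; rewrite !mxE; ring.
  (* [H] is recovered from [X] and [w] because [X A - X B] is nonzero; [F] then follows from [X] and
     [H]. *)
  have EH : (1 - t) * H p + t * H q = (1 - t') * H u + t' * H v.
    have D : X A - X B != 0 by rewrite subr_eq0 gt_eqF.
    have {}wE m : (X A - X B) * H m =
        dot w (f m) - dot w (f a) + (H A - H B) * X m.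
      by rewrite -dotB wE subrK.
    have {}EY : (1 - t) * dot w (f p) + t * dot w (f q) =
        (1 - t') * dot w (f u) + t' * dot w (f v).
      apply: (mulfI s0); transitivity ((1 - t) * (s * dot w (f p)) + t * (s * dot w (f q))).
        by ring.
      by move: EY; rewrite !dotZl => ->; ring.
    apply: (mulfI D); transitivity ((1 - t) * ((X A - X B) * H p) + t * ((X A - X B) * H q)).
      by ring.
    transitivity ((1 - t) * dot w (f p) + t * dot w (f q) - dot w (f a)
      + (H A - H B) * ((1 - t) * X p + t * X q)); first by rewrite !wE; ring.
    transitivity ((1 - t') * ((X A - X B) * H u) + t' * ((X A - X B) * H v)).
      by rewrite EY EX !wE; ring.
    by ring.
  rewrite !comb EH; congr (_ + (_ *: _ + _)); apply/esym; move: EX; rewrite /X => EX.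
  transitivity ((1 - t) * (F p + l * H p) + t * (F q + l * H q)
    - l * ((1 - t) * H p + t * H q)); first by ring.
  by rewrite EX EH; ring.
- split=> //; apply/eqP => E; move: CA; rewrite -E ?ltxx //.
  by rewrite !dotZl wAB ltxx.
Qed.

Lemma slope_neq (X Y : G -> R) A u w : injective X ->
  (forall v, X v <= X A) ->
  (forall p q u v, segments_meet X Y p q u v ->
     exists2 m, segment (f p) (f q) m & segment (f u) (f v) m) ->
  adj A u -> adj A w -> u != w -> slope X Y A u != slope X Y A w.
Proof.
move=> X_inj A_max meet; wlog wu : u w / X w < X u.
  move=> W Au Aw uw; have [lt|lt|/X_inj E] := ltgtP (X w) (X u).
  - exact: W.
  - by rewrite eq_sym W // eq_sym.
  - by rewrite E eqxx in uw.
move=> Au Aw uw; apply/eqP => E.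
have lt v : adj A v -> X v < X A.
  by move=> Av; rewrite lt_neqAle A_max andbT (inj_eq X_inj) eq_sym adj_neq.
have [uA wA] := (lt u Au, lt w Aw).
have D : X A - X w != 0 by rewrite subr_eq0 gt_eqF.
have D' : X A - X u != 0 by rewrite subr_eq0 gt_eqF.
(* [u] is nearer to [A] than [w], so equal slopes would put it on the edge [A w]; [u u] is the
   degenerate segment at that point. *)
have [] := meet A w u u.
  exists ((X A - X u) / (X A - X w)), 0; split; last 2 first.
  - by field.
  - transitivity (Y A + slope X Y A w * (X A - X u)); first by rewrite /slope; field.
    by rewrite -E /slope; field.
  - by rewrite divr_ge0 ?ler_pdivrMr ?mul1r /=; lra.
  - by rewrite lexx ler01.
move=> m Awm [t _ mE]; case: f_cf => _ h _.
have {}mE : m = f u by rewrite -mE -scalerDl subrK scale1r.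
rewrite mE in Awm; case: (h _ _ _ Aw Awm) => uE.
- by move: (adj_neq Au); rewrite uE eqxx.
- by rewrite uE eqxx in uw.
Qed.

Lemma planar_adj p q u v : adj p q -> adj u v ->
  p != u -> p != v -> q != u -> q != v ->
  forall m, segment (f p) (f q) m -> segment (f u) (f v) m -> False.
Proof.
move=> pq uv pu pv qu qv m pqm uvm; case: f_cf => _ _ h.
have [|w []] := h p q u v pq uv _ m pqm uvm.
  apply/eqP => /setP/(_ p); rewrite !finset.inE eqxx /= => /esym.
  by rewrite (negPf pu) (negPf pv).
rewrite !finset.inE => /orP[]/eqP-> /orP[]/eqP E _; move: pu pv qu qv;
by rewrite E eqxx.
Qed.

(** The neighbours of the rightmost [A] are sorted by slope. The middle one serves as [n], and the
    cycle through the outer two contains [A], [B] and [C]. *)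
Lemma planar_cubic a b c (Q : G -> G -> G -> Prop) : coplanar a b c ->
  (forall v, #|nbrs v| = 3) -> opposite_cycles Q ->
  exists A B C, [/\ extremal f A, extremal f B, extremal f C,
    [/\ A != B, A != C & B != C] & Q A B C].
Proof.
move=> /planar_frame[X [Y [A [B [C [X_inj meet [eA eB eC] neq [A_max B_min C_max]]]]]]].
move=> deg opp; exists A, B, C; split=> //.
have /card_gt2P[x [y [z [[]]]]] : (2 < #|nbrs A|)%N by rewrite deg.
rewrite !finset.inE => Ax Ay Az [xy yz zx].
have sxy := slope_neq X_inj A_max meet Ax Ay xy.
have syz := slope_neq X_inj A_max meet Ay Az yz.
have szx := slope_neq X_inj A_max meet Az Ax zx.
pose s := slope X Y A.
have main n p q : adj A n -> adj A p -> adj A q -> n != p -> n != q -> p != q ->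
    s q < s n -> s n < s p -> Q A B C.
  move=> An Ap Aq np nq pq lt1 lt2.
  have [t [[qE pt AN nN] [conn]]] := opp A n p q An Ap Aq np nq pq.
  rewrite -qE in Aq lt1.
  have on w : (forall v, X w <= X v) \/ (forall v, Y v <= Y w) -> w \in A :: p :: t.
    apply: (@extremes_on_polygon _ _ X Y (@adj G) X_inj (@adj_sym G) adj_neq _ A n p t w) => //.
    + move=> p' q' u v pq' uv pu pv qu qv /meet[m]; exact: planar_adj.
    + by rewrite adj_sym.
  move=> h; case: neq => AB AC BC.
  have onB := on B (or_introl B_min); have onC := on C (or_intror C_max).
  exact: h _ _ _ (mem_head _ _) onB onC AB AC BC.
have [lxy|lxy|/eqP] := ltgtP (s x) (s y); last by rewrite (negPf sxy).
- have [lyz|lyz|/eqP] := ltgtP (s y) (s z); last by rewrite (negPf syz).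
    by apply: (main y z x) => //; rewrite eq_sym.
  have [lzx|lzx|/eqP] := ltgtP (s z) (s x); last by rewrite (negPf szx).
    by apply: (main x y z) => //; rewrite eq_sym.
  by apply: (main z y x) => //; rewrite eq_sym.
- have [lyz|lyz|/eqP] := ltgtP (s y) (s z); last by rewrite (negPf syz).
    have [lzx|lzx|/eqP] := ltgtP (s z) (s x); last by rewrite (negPf szx).
      by apply: (main z x y) => //; rewrite eq_sym.
    by apply: (main x z y) => //; rewrite eq_sym.
  by apply: (main y x z) => //; rewrite eq_sym.
Qed.

(** * Cubic graphs *)

Section Cubic.
Hypothesis deg3 : forall v, #|nbrs v| = 3.

Definition extremals : {set G} := [set v | `[< extremal f v >]].

Lemma cubic_inc v : (2 <= #|inc v|)%N.
Proof. by have := inc_ge v; rewrite deg3; lia. Qed.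

Lemma cubic_inc_extremal v : extremal f v -> (3 <= #|inc v|)%N.
Proof. by move=> /inc_ge_extremal; rewrite deg3. Qed.

Lemma cubic_noncollinear : (0 < #|G|)%N ->
  exists v x y, [/\ adj v x, adj v y & noncollinear f v x y].
Proof.
by case/card_gt0P=> v _; exists v; apply: noncollinear_nbrs; rewrite deg3.
Qed.

(** Two lines at a vertex give one pair, and three lines at an extremal vertex give three, which is
    two more. *)
Lemma cubic_pairs : (#|G| + 2 * #|extremals| <= \sum_v 'C(#|inc v|, 2))%N.
Proof.
have -> : (2 * #|extremals| = \sum_(v in extremals) 2)%N by rewrite sum_nat_const mulnC.
rewrite -sum1_card [X in (_ + X)%N]big_mkcond -big_split /=.
apply: leq_sum => v _; rewrite finset.inE; case: asboolP => [/cubic_inc_extremal|_].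
- by move=> h; apply: leq_trans (leq_bin2l 2 h).
- by apply: leq_trans (leq_bin2l 2 (cubic_inc v)).
Qed.

Lemma three_extremals_coplanar : (0 < #|G|)%N -> (#|extremals| <= 3)%N ->
  exists a b c, coplanar a b c.
Proof.
move=> G_gt0 E3; have [v [x [y [_ _ nc]]]] := cubic_noncollinear G_gt0.
have [A [B [C [eA eB eC ncE]]]] := exists_noncollinear_extremal f_inj nc.
exists A, B, C; apply: coplanar_extremals => // w ew.
have [AB AC BC] := noncollinear_neq ncE.
suff : w \in [set A; B; C].
  by rewrite !finset.inE -orbA => /or3P[]/eqP->; [constructor 1|constructor 2|constructor 3].
have /eqP -> : [set A; B; C] == extremals; last by rewrite finset.inE; apply/asboolP.
rewrite eqEcard; apply/andP; split.
  by apply/fintype.subsetP => v'; rewrite !finset.inE -orbA => /or3P[]/eqP->; apply/asboolP.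
apply: leq_trans E3 _; rewrite -finset.setUA cardsU1 cards2 BC !finset.inE negb_or AB AC.
by [].
Qed.

Lemma tight_coplanar : (0 < #|G|)%N -> ('C(k, 2) <= \sum_v 'C(#|inc v|, 2))%N ->
  exists a b c, coplanar a b c.
Proof.
move=> G_gt0 tight; have [v [x [y [vx vy nc]]]] := cubic_noncollinear G_gt0.
exists v, x, y; apply: meet_coplanar => // [|i j]; first exact: cubic_inc.
exact: pairs_tight_meet.
Qed.

(* Deleting the line through two adjacent extremal vertices, which carries no
   other vertex, leaves at least two lines at every vertex. *)
Lemma adj_extremals_bound A B C : extremal f A -> extremal f B -> extremal f C ->
  A != C -> B != C -> adj A B -> (#|G| + 2 <= 'C(k - 1, 2))%N.
Proof.
move=> eA eB eC AC BC AB; have [i iA iB] := adj_inc AB.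
have := sum_pairs_off [set i]; rewrite cards1; apply: leq_trans.
have off v : v != A -> v != B -> inc v :\: [set i] = inc v.
  move=> vA vB; apply/finset.setDidPl; rewrite disjoint_sym disjoints1.
  by apply/negP => /(adj_extremals_line eA eB AB iA iB)[] /eqP; apply/negP.
rewrite (bigD1 C) //= off 1?eq_sym // -sum1_card (bigD1 C) //= addnAC.
apply: leq_add; first by apply: leq_trans (leq_bin2l 2 (cubic_inc_extremal eC)).
apply: leq_sum => v _.
have [->|vA] := eqVneq v A; last have [->|vB] := eqVneq v B.
- have := cardsD1 i (inc A); rewrite iA => cE; have := cubic_inc_extremal eA.
  by rewrite cE => h; apply: leq_trans (leq_bin2l 2 (h : 2 <= #|_|)%N).
- have := cardsD1 i (inc B); rewrite iB => cE; have := cubic_inc_extremal eB.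
  by rewrite cE => h; apply: leq_trans (leq_bin2l 2 (h : 2 <= #|_|)%N).
- by rewrite off //; apply: leq_trans (leq_bin2l 2 (cubic_inc v)).
Qed.

(** Delete the lines of [A B] and [B C]. Each of [A] and [C] loses one line of at least three, and
    other vertices except [B] lose none; the summand 1 makes up for [B]. *)
Lemma path_extremals_bound A B C : extremal f A -> extremal f B -> extremal f C ->
  A != C -> adj A B -> adj B C -> (#|G| <= 'C(k - 2, 2) + 1)%N.
Proof.
move=> eA eB eC AC AB BC; have [i iA iB] := adj_inc AB; have [j jB jC] := adj_inc BC.
have ABN := adj_neq AB; have BCN := adj_neq BC.
have iC : i \notin inc C.
  by apply/negP => /(adj_extremals_line eA eB AB iA iB)[] E; [move: AC|move: BCN]; rewrite E eqxx.
have jA : j \notin inc A.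
  by apply/negP => /(adj_extremals_line eB eC BC jB jC)[] E; [move: ABN|move: AC]; rewrite E eqxx.
have ij : i != j by apply: contraNneq iC => ->.
have := sum_pairs_off [set i; j]; rewrite cards2 ij /= => bound.
apply: leq_trans (leq_add bound (leqnn 1)).
rewrite -sum1_card (bigD1 B) //= addnC leq_add2r [leqRHS](bigD1 B) //=.
apply: leq_trans (leq_addl _ _); apply: leq_sum => v vB.
have jv : v != A -> v != C -> inc v :\: [set i; j] = inc v.
  move=> vA vC; apply/finset.setDidPl; rewrite disjoint_sym finset.disjoints_subset.
  apply/fintype.subsetP => l; rewrite !finset.inE => /orP[]/eqP->; apply/negP.
    by move=> /(adj_extremals_line eA eB AB iA iB)[] /eqP; apply/negP.
  by move=> /(adj_extremals_line eB eC BC jB jC)[] /eqP; apply/negP.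
have del w l : l \in inc w -> extremal f w ->
    (2 <= #|inc w :\ l|)%N.
  by move=> lw /cubic_inc_extremal; rewrite (cardsD1 l) lw.
have [->|vA] := eqVneq v A; last have [->|vC] := eqVneq v C.
- apply: leq_trans (leq_bin2l 2 (del A i iA eA)) (leq_bin2l 2 (subset_leq_card _)).
  apply/fintype.subsetP => l; rewrite !finset.inE => /andP[li lA].
  by rewrite lA andbT negb_or li; apply: contraNneq jA => <-.
- apply: leq_trans (leq_bin2l 2 (del C j jC eC)) (leq_bin2l 2 (subset_leq_card _)).
  apply/fintype.subsetP => l; rewrite !finset.inE => /andP[lj lC].
  by rewrite lC andbT negb_or lj andbT; apply: contraNneq iC => <-.
- by rewrite jv //; apply: leq_trans (leq_bin2l 2 (cubic_inc v)).
Qed.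

(** With at least four extremal vertices, [cubic_pairs] gives at least [#|G| + 8] pairs, so every
    pair of lines meets at a vertex. *)
Lemma cubic_coplanar : (0 < #|G|)%N -> ('C(k, 2) <= #|G| + 8)%N -> exists a b c, coplanar a b c.
Proof.
move=> G_gt0 small; have [|E4] := leqP #|extremals| 3; first exact: three_extremals_coplanar.
by apply: tight_coplanar; have := cubic_pairs; lia.
Qed.
End Cubic.

(** Of three vertices on a quadrilateral one is adjacent to both others. For six lines, 15 pairs are
    at most 8 + 8, which forces planarity, and 6 + 1 < 8 refutes it. *)
Lemma cube_lower_bound : (forall v, #|nbrs v| = 3) -> #|G| = 8 ->
  opposite_cycles (fun x y z : G =>
    [\/ adj x y /\ adj y z, adj y z /\ adj z x | adj z x /\ adj x y]) ->
  (6 < k)%N.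
Proof.
move=> deg G8 opp; rewrite ltnNge; apply/negP => k6.
have G_gt0 : (0 < #|G|)%N by rewrite G8.
have small : ('C(k, 2) <= #|G| + 8)%N by rewrite G8; apply: leq_trans (leq_bin2l 2 k6) _.
have [a [b [c /planar_cubic cop]]] := cubic_coplanar deg G_gt0 small.
have [A [B [C [eA eB eC [AB AC BC] Q]]]] := cop _ deg opp.
have le6 : ('C(k - 2, 2) + 1 <= 7)%N.
  by rewrite addn1 ltnS; apply: leq_trans (leq_bin2l 2 (leq_sub2r 2 k6)) _.
suff : (#|G| <= 'C(k - 2, 2) + 1)%N by rewrite G8 => /leq_trans/(_ le6).
case: Q => -[h1 h2].
- exact: (path_extremals_bound deg eA eB eC).
- by apply: (path_extremals_bound deg eB eC eA) => //; rewrite eq_sym.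
- by apply: (path_extremals_bound deg eC eA eB) => //; rewrite eq_sym.
Qed.

(** Of three vertices on a pentagon two are adjacent. For eight lines, 28 pairs equal 20 + 8, which
    forces planarity, and 21 < 22 refutes it. *)
Lemma dodecahedron_lower_bound : (forall v, #|nbrs v| = 3) -> #|G| = 20 ->
  opposite_cycles (fun x y z : G => [\/ adj x y, adj y z | adj z x]) -> (8 < k)%N.
Proof.
move=> deg G20 opp; rewrite ltnNge; apply/negP => k8.
have G_gt0 : (0 < #|G|)%N by rewrite G20.
have small : ('C(k, 2) <= #|G| + 8)%N by rewrite G20; apply: leq_trans (leq_bin2l 2 k8) _.
have [a [b [c /planar_cubic cop]]] := cubic_coplanar deg G_gt0 small.
have [A [B [C [eA eB eC [AB AC BC] Q]]]] := cop _ deg opp.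
have le21 : ('C(k - 1, 2) <= 21)%N.
  by apply: leq_trans (leq_bin2l 2 (leq_sub2r 1 k8)) _.
suff : (#|G| + 2 <= 'C(k - 1, 2))%N by rewrite G20 => /leq_trans/(_ le21).
case: Q => h.
- exact: (adj_extremals_bound deg eA eB eC).
- by apply: (adj_extremals_bound deg eB eC eA) => //; rewrite eq_sym.
- by apply: (adj_extremals_bound deg eC eA eB) => //; rewrite eq_sym.
Qed.

(** * Graphs of degree five on at most twelve lines *)

Section Icosahedron.
Hypothesis deg5 : forall v, #|nbrs v| = 5.
Hypothesis k_le12 : (k <= 12)%N.

Let inc_ge3 v : (3 <= #|inc v|)%N.
Proof. by have := inc_ge v; rewrite deg5; lia. Qed.

Let inc_extremal v : extremal f v -> (5 <= #|inc v|)%N.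
Proof. by move=> /inc_ge_extremal; rewrite deg5. Qed.

(** A fourth extremal vertex would require 4 * 5 - 6 = 14 lines. *)
Lemma three_extremals A B C v : extremal f A -> extremal f B -> extremal f C ->
  A != B -> A != C -> B != C -> extremal f v -> [\/ v = A, v = B | v = C].
Proof.
move=> eA eB eC AB AC BC ev.
have [->|vA] := eqVneq v A; first by constructor 1.
have [->|vB] := eqVneq v B; first by constructor 2.
have [->|vC] := eqVneq v C; first by constructor 3.
rewrite eq_sym in vA; rewrite eq_sym in vB; rewrite eq_sym in vC.
have := card_inc4 AB AC BC vA vB vC.
have := inc_extremal eA; have := inc_extremal eB; have := inc_extremal eC.
have := inc_extremal ev; move=> *; lia.
Qed.

(** The bound 5 + 5 + 5 - 3 = 12 is attained: each corner has exactly five lines, two of which are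
    sides of the triangle, and no line misses all corners. *)
Lemma extremal_lines A B C : extremal f A -> extremal f B -> extremal f C ->
  A != B -> A != C -> B != C ->
  [/\ #|inc A :\: (inc B :|: inc C)| = 3, #|inc A :&: inc C| = 1%N
    & forall i, i \notin inc A -> i \notin inc B -> i \in inc C].
Proof.
move=> eA eB eC AB AC BC.
have lA := inc_extremal eA; have lB := inc_extremal eB; have lC := inc_extremal eC.
have mAB := inc_meet AB; have mAC := inc_meet AC; have mBC := inc_meet BC.
have U1 := cardsUI (inc A) (inc B).
have U2 := cardsUI (inc A :|: inc B) (inc C).
have U3 := cardsUI (inc A :&: inc C) (inc B :&: inc C).
have U4 := cardsUI (inc A :&: inc B) (inc A :&: inc C).
have U5 := cardsID (inc B :|: inc C) (inc A).
have E4 : (inc A :&: inc B) :&: (inc A :&: inc C) = (inc A :&: inc C) :&: (inc B :&: inc C).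
  by apply/setP => i; rewrite !finset.in_setI; do 3 case: (i \in inc _).
rewrite finset.setIUl in U2; rewrite finset.setIUr in U5; rewrite E4 in U4.
have := cardsC (inc A :|: inc B :|: inc C); rewrite card_ord => cC.
split; [lia|lia|move=> i iA iB].
have /eqP : #|~: (inc A :|: inc B :|: inc C)| = 0%N by lia.
rewrite cards_eq0 => /eqP/setP/(_ i); rewrite !finset.in_setC !finset.in_setU finset.in_set0.
by rewrite (negPf iA) (negPf iB) => /negbFE.
Qed.

(** Of at least three lines at [v], at most one passes through [B] and at most one through [C]; a
    remaining one passes through [A]. *)
Lemma apex_line A B C v : A != v -> B != v -> C != v ->
  (forall i, i \notin inc A -> i \notin inc B -> i \in inc C) ->
  exists2 i, i \in inc v & i \in inc A :\: (inc B :|: inc C).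
Proof.
move=> vA vB vC cov; apply: contrapT => /forall2NP h.
have := inc_ge3 v; rewrite leqNgt => /negP; apply; rewrite ltnS.
apply: (@leq_trans #|(inc B :&: inc v) :|: (inc C :&: inc v)|).
  apply: subset_leq_card; apply/fintype.subsetP => i iv.
  rewrite -finset.setIUl finset.in_setI iv andbT.
  case: (h i) => [/negP|/negP]; first by rewrite iv.
  rewrite finset.in_setD negb_and negbK => /orP[//|iA].
  rewrite finset.in_setU; case: (boolP (i \in inc B)) => //= iB.
  exact: cov.
apply: leq_trans (leq_card_setU _ _) _.
by rewrite (leq_add (inc_meet vB) (inc_meet vC)).
Qed.
End Icosahedron.

Lemma line_scale i P X X' : i \in inc P -> i \in inc X -> i \in inc X' -> P != X' ->
  exists s, f X - f P = s *: (f X' - f P).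
Proof.
move=> /inc_on iP /inc_on iX /inc_on iX' PX'.
have [s ->] := (line_span (f X) (L_line i) iP iX' (f_neq PX')).1 iX.
by exists s; rewrite addrC addKr.
Qed.

(** On the side [P Q], the vertex [X] would share with [P] both this side and the line [j], which
    avoids [Q]. *)
Lemma off_side P Q X i j s : P != Q -> X != P -> i \in inc P -> i \in inc Q ->
  j \in inc X -> j \in inc P :\: inc Q -> f X - f P = s *: (f Q - f P) -> False.
Proof.
move=> PQ XP iP iQ jX; rewrite finset.in_setD => /andP[jQ jP] XE.
have iX : i \in inc X.
  apply: (inc_closed iP).
  apply/(line_span (f X) (L_line i) (inc_on iP) (inc_on iQ) (f_neq PQ)).
  by exists s; rewrite -XE addrC subrK.
by move: jQ; rewrite -(inc_eq XP iX iP jX jP) iQ.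
Qed.

Lemma extremal_ge (w : 'rV[R]_3) A B C :
  (forall v, extremal f v -> [\/ v = A, v = B | v = C]) ->
  dot w (f A) <= dot w (f B) -> dot w (f A) <= dot w (f C) ->
  forall v, dot w (f A) <= dot w (f v).
Proof.
move=> ext wB wC v; have [u /ext u_ext u_max] := extremal_max f_inj (- w) v.
apply: (@le_trans _ _ (dot w (f u))); last by have := u_max v; rewrite !dotNl lerN2.
by case: u_ext => ->.
Qed.

Lemma icosahedron_lower_bound : (forall v, #|nbrs v| = 5) -> #|G| = 12 -> (12 < k)%N.
Proof.
move=> deg G12; rewrite ltnNge; apply/negP => k12.
have [v0 _] : exists v0 : G, v0 \in G by apply/card_gt0P; rewrite G12.
have [] := @noncollinear_nbrs v0; rewrite ?deg // => v1 [v2 [_ _ nc0]].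
have [A [B [C [eA eB eC nc]]]] := exists_noncollinear_extremal f_inj nc0.
have [AB AC BC] := noncollinear_neq nc.
have [BA CA CB] : [/\ B != A, C != A & C != B] by split; rewrite eq_sym.
have ext v : extremal f v -> [\/ v = A, v = B | v = C].
  exact: (three_extremals deg k12 eA eB eC).
have [SA3 mAC covC] := extremal_lines deg k12 eA eB eC AB AC BC.
have [SB3 mBA covA] := extremal_lines deg k12 eB eC eA BC BA CA.
have [SC3 mCB covB] := extremal_lines deg k12 eC eA eB CA CB AB.
have [_ flat] := coplanar_extremals nc ext.
have [wy [wz [y1 y0 z0 z1 yz]]] := plane_coordinates nc.
(* [x], [y], [z] are the barycentric coordinates with respect to [A], [B], [C]. *)
pose y v := dot wy (f v - f A); pose z v := dot wz (f v - f A).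
pose x v := 1 - y v - z v.
have fE v : f v - f A = y v *: (f B - f A) + z v *: (f C - f A) by apply/yz/flat.
have yA : y A = 0 by rewrite /y subrr /dot !mxE !mulr0 !addr0.
have zA : z A = 0 by rewrite /z subrr /dot !mxE !mulr0 !addr0.
have yD u v : y u - y v = dot wy (f u - f v) by rewrite /y !dotB; ring.
have zD u v : z u - z v = dot wz (f u - f v) by rewrite /z !dotB; ring.
have xD u v : x u - x v = dot (- (wy + wz)) (f u - f v).
  by rewrite dotNl dotDl -yD -zD /x; ring.
have zB : z B = 0 by [].
have yC : y C = 0 by [].
have xA : x A = 1 by rewrite /x yA zA; ring.
have xB : x B = 0 by rewrite /x [y B]y1 zB; ring.
have xC : x C = 0 by rewrite /x yC [z C]z1; ring.
pose inner := ~: [set A; B; C].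
have innerP X : X \in inner -> [/\ X != A, X != B & X != C].
  by rewrite !finset.inE !negb_or -andbA => /and3P[].
have pick_line P Q S : #|inc P :\: (inc Q :|: inc S)| = 3 ->
    (forall i, i \notin inc P -> i \notin inc Q -> i \in inc S) ->
    exists h : G -> 'I_k, forall X, X != P -> X != Q -> X != S ->
      h X \in inc X /\ h X \in inc P :\: (inc Q :|: inc S).
  move=> S3 cov; suff /choice[h hP] : forall X, exists i, X != P -> X != Q -> X != S ->
      i \in inc X /\ i \in inc P :\: (inc Q :|: inc S) by exists h.
  move=> X.
  (* [i0] is a default value for the corners of the triangle. *)
  have [i0 _] : exists i, i \in inc P :\: (inc Q :|: inc S).
    by apply/card_gt0P; rewrite S3.
  case: (boolP [&& X != P, X != Q & X != S]) => [/and3P[XP XQ XS]|no].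
    rewrite eq_sym in XP; rewrite eq_sym in XQ; rewrite eq_sym in XS.
    by have [i iX iP] := apex_line deg k12 XP XQ XS cov; exists i.
  by exists i0 => XP XQ XS; rewrite XP XQ XS in no.
have [ia iaP] := pick_line A B C SA3 covC.
have [ib ibP] := pick_line B C A SB3 covA.
have [ic icP] := pick_line C A B SC3 covB.
have side P Q : #|inc P :&: inc Q| = 1%N -> exists2 i, i \in inc P & i \in inc Q.
  move=> PQ1; have /card_gt0P[i] : (0 < #|inc P :&: inc Q|)%N by rewrite PQ1.
  by rewrite finset.in_setI => /andP[iP iQ]; exists i.
(* The coordinates are nonnegative since they are so at the three extremal vertices; a zero would
   put [X] on a side, against [off_side]. *)
have pos X : X \in inner -> [/\ 0 < x X, 0 < y X & 0 < z X].
  move=> /innerP[XA XB XC].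
  have [iaX] := iaP X XA XB XC; have [ibX] := ibP X XB XC XA; have [icX] := icP X XC XA XB.
  rewrite !finset.in_setD !finset.in_setU !negb_or.
  move=> /andP[/andP[ncA ncB] icC] /andP[/andP[nbC nbA] ibB] /andP[/andP[naB naC] iaA].
  split; rewrite lt_def; apply/andP; split.
  - apply/eqP => x0; have [i iC iB] := side _ _ mCB.
    apply: (@off_side C B X i (ic X) (y X) CB XC iC iB icX); first by rewrite finset.in_setD ncB.
    rewrite -(subrKA (f A)) -[f A - f C]opprB fE.
    have -> : y X = 1 - z X by move: x0; rewrite /x; lra.
    by apply: row3P; rewrite !mxE; ring.
  - have -> : x X = dot (- (wy + wz)) (f X) - dot (- (wy + wz)) (f B).
      by rewrite -dotB -xD xB subr0.
    rewrite subr_ge0.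
    apply: (@extremal_ge _ B C A) => [v /ext[]->||];
      try by [constructor 1|constructor 2|constructor 3].
      by rewrite -subr_ge0 -dotB -xD xB xC subrr.
    by rewrite -subr_ge0 -dotB -xD xA xB subr0 ler01.
  - apply/eqP => yX0; have [i iA iC] := side _ _ mAC.
    apply: (@off_side A C X i (ia X) (z X) AC XA iA iC iaX); first by rewrite finset.in_setD naC.
    by rewrite fE yX0 scale0r add0r.
  - rewrite /y dotB subr_ge0; apply: (extremal_ge ext); rewrite -subr_ge0 -dotB ?y1 ?y0 //.
  - apply/eqP => zX0; have [i iB iA] := side _ _ mBA.
    apply: (@off_side B A X i (ib X) (1 - y X) BA XB iB iA ibX).
      by rewrite finset.in_setD nbA.
    rewrite -(subrKA (f A)) fE zX0 scale0r addr0.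
    by apply: row3P; rewrite !mxE; ring.
  - rewrite /z dotB subr_ge0; apply: (extremal_ge ext); rewrite -subr_ge0 -dotB ?z1 ?z0 //.
have scale_ratio (a b a' b' s : R) : 0 < b -> 0 < b' -> a = s * a' -> b = s * b' ->
    a / b = a' / b'.
  move=> b0 b0' -> bE; have s0 : s != 0.
    by apply: contraTneq b0 => s0; rewrite bE s0 mul0r ltxx.
  by rewrite bE; field; rewrite s0 gt_eqF.
apply: (@no_multiplicative_net R G 'I_k inner _ _ _ ia ib ic
  (fun X => y X / z X) (fun X => z X / x X) _ SA3 SB3 SC3).
- have c3 : #|[set A; B; C]| = 3.
    by rewrite -finset.setUA cardsU1 cards2 BC !finset.inE negb_or AB AC.
  by have := cardsC [set A; B; C]; rewrite c3 G12 => -[].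
- move=> X /innerP[XA XB XC]; have [_ a] := iaP X XA XB XC.
  by have [_ b] := ibP X XB XC XA; have [_ c] := icP X XC XA XB.
- move=> X X' /innerP[XA XB XC] /innerP[X'A X'B X'C] Ea Eb.
  have [a1 a2] := iaP X XA XB XC; have [b1 b2] := ibP X XB XC XA.
  have [a1' _] := iaP X' X'A X'B X'C; have [b1' _] := ibP X' X'B X'C X'A.
  apply/eqP/negPn/negP => XX'.
  rewrite -Ea in a1'; rewrite -Eb in b1'; have E := inc_eq XX' a1 a1' b1 b1'.
  move: a2 b2; rewrite E !finset.in_setD !finset.in_setU !negb_or.
  by move=> /andP[/andP[/negPf-> _] _] /andP[].
- move=> X X' /innerP[XA XB XC] /innerP[X'A X'B X'C] Ea Ec.
  have [a1 a2] := iaP X XA XB XC; have [c1 c2] := icP X XC XA XB.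
  have [a1' _] := iaP X' X'A X'B X'C; have [c1' _] := icP X' X'C X'A X'B.
  apply/eqP/negPn/negP => XX'.
  rewrite -Ea in a1'; rewrite -Ec in c1'; have E := inc_eq XX' a1 a1' c1 c1'.
  move: a2 c2; rewrite E !finset.in_setD !finset.in_setU !negb_or.
  by move=> /andP[/andP[_ /negPf->] _] /andP[].
- by move=> X /pos[x0 y0' z0']; rewrite !divr_gt0.
- move=> X X' XI X'I Ea; have [[XA XB XC] [X'A X'B X'C]] := (innerP X XI, innerP X' X'I).
  have [_ _ zX] := pos X XI; have [_ _ zX'] := pos X' X'I.
  have [a1 a2] := iaP X XA XB XC; have [a1' _] := iaP X' X'A X'B X'C.
  rewrite finset.in_setD in a2; case/andP: a2 => _ a2; rewrite -Ea in a1'.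
  have [|s sE] := line_scale a2 a1 a1'; first by rewrite eq_sym.
  apply: (@scale_ratio _ _ _ _ s) => //.
    by rewrite -[y X]subr0 -[y X']subr0 -yA !yD sE dotZ.
  by rewrite -[z X]subr0 -[z X']subr0 -zA !zD sE dotZ.
- move=> X X' XI X'I Eb; have [[XA XB XC] [X'A X'B X'C]] := (innerP X XI, innerP X' X'I).
  have [xX _ _] := pos X XI; have [xX' _ _] := pos X' X'I.
  have [b1 b2] := ibP X XB XC XA; have [b1' _] := ibP X' X'B X'C X'A.
  rewrite finset.in_setD in b2; case/andP: b2 => _ b2; rewrite -Eb in b1'.
  have [|s sE] := line_scale b2 b1 b1'; first by rewrite eq_sym.
  apply: (@scale_ratio _ _ _ _ s) => //.
    by rewrite -[z X]subr0 -[z X']subr0 -zB !zD sE dotZ.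
  by rewrite -[x X]subr0 -[x X']subr0 -xB !xD sE dotZ.
- move=> X X' XI X'I Ec; have [[XA XB XC] [X'A X'B X'C]] := (innerP X XI, innerP X' X'I).
  have [xX yX zX] := pos X XI; have [xX' yX' zX'] := pos X' X'I.
  have [c1 c2] := icP X XC XA XB; have [c1' _] := icP X' X'C X'A X'B.
  rewrite finset.in_setD in c2; case/andP: c2 => _ c2; rewrite -Ec in c1'.
  have [|s sE] := line_scale c2 c1 c1'; first by rewrite eq_sym.
  (* The product of the two ratios is [y / x]. *)
  rewrite !mulrA !divfK ?gt_eqF //; apply: (@scale_ratio _ _ _ _ s) => //.
    by rewrite -[y X]subr0 -[y X']subr0 -yC !yD sE dotZ.
  by rewrite -[x X]subr0 -[x X']subr0 -xC !xD sE dotZ.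
- move=> X X' /pos[xX yX zX] /pos[xX' yX' zX'] /eqP hp /eqP hq.
  have {}hp : y X * z X' = y X' * z X by apply/eqP; rewrite -eqr_div ?lt0r_neq0.
  have {}hq : z X * x X' = z X' * x X by apply/eqP; rewrite -eqr_div ?lt0r_neq0.
  (* Both ratios agree and the coordinates sum to 1, which determines the point. *)
  have zE : z X = z X'.
    transitivity (z X * x X' + z X * y X' + z X * z X'); first by rewrite /x; ring.
    rewrite hq [z X * y X']mulrC -hp.
    by rewrite /x; ring.
  have yE : y X = y X' by apply: (mulIf (lt0r_neq0 zX')); rewrite hp zE.
  by apply/f_inj/(addIr (- f A)); rewrite (fE X) (fE X') yE zE.
Qed.
End Arrangement.

(** * Platonic graphs *)

Section SkeletonChecks.
Variables (n : nat) (faces : seq (seq nat)).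
Notation G := (skeleton n faces).

Definition nat_adj (i j : nat) : bool :=
  (i != j) && has (fun F => (next F i == j) || (next F j == i)) faces.

Lemma adjE (u v : G) : adj u v = nat_adj (val u) (val v).
Proof. by []. Qed.

Definition regular_check (d : nat) : bool :=
  all (fun i => count (nat_adj i) (iota 0 n) == d) (iota 0 n).

Lemma regular_checkP d : regular_check d -> forall v : G, #|nbrs v| = d.
Proof.
move=> /allP h v; have /eqP <- : count (nat_adj v) (iota 0 n) == d.
  by apply: h; rewrite mem_iota add0n ltn_ord.
rewrite -val_enum_ord count_map -size_filter cardE [enum (nbrs v)]/enum_mem -enumT.
by congr size; apply: eq_filter => u; rewrite /= finset.inE.
Qed.

Definition off (C : seq nat) : seq nat := [seq i <- iota 0 n | i \notin C].

(** A search from the first vertex off [C]. The number of rounds affects only whether the check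
    succeeds, not its soundness. *)
Definition off_connected_check (C : seq nat) : bool :=
  let reach := iter n./2 (fun S => [seq i <- off C | (i \in S) || has (nat_adj i) S])
                 (take 1 (off C)) in
  all [in reach] (off C).

Lemma off_connected_checkP (s : seq G) C : map val s =i C ->
  off_connected_check C -> off_connected s.
Proof.
move=> sC /allP check g g_adj u v us vs.
(* The search runs on numbers, so [g] is extended by [false] beyond the vertices. *)
pose gn i := if insub i is Some w then g w else false.
have gnE (w : G) : gn (val w) = g w by rewrite /gn valK.
have offE (w : G) : w \notin s -> val w \in off C.
  by move=> ws; rewrite mem_filter -sC mem_map ?ws ?mem_iota ?ltn_ord //; apply: val_inj.
have offP i : i \in off C -> exists2 w : G, w \notin s & i = val w.
  rewrite mem_filter mem_iota add0n => /andP[iN i_n]; exists (Ordinal i_n) => //.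
  by apply: contra iN => ws; rewrite -sC; apply/mapP; exists (Ordinal i_n).
have same i : i \in off C -> gn i = gn (head 0%N (off C)).
  move=> /check; set S0 := off _.
  elim: n./2 i => [|m IH] i; first by rewrite /=; case: S0 => //= ? ?; rewrite take0 inE => /eqP->.
  rewrite /= mem_filter => /andP[/orP[/IH //|/hasP[j jS ij]]] iS0.
  rewrite -(IH j jS).
  have jS0 : j \in S0.
    case: m {IH} jS => [/mem_take //|m]; by rewrite /= mem_filter => /andP[].
  have [w ws wE] := offP i iS0; have [w' w's w'E] := offP j jS0.
  by rewrite wE w'E !gnE; apply: g_adj => //; rewrite adjE -wE -w'E.
by rewrite -!gnE !same ?offE.
Qed.

Definition face_check (Q : nat -> nat -> nat -> bool) (F : seq nat) : bool :=
  off_connected_check F &&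
  all (fun x => all (fun y => all (fun z =>
    [|| x == y, x == z, y == z | Q x y z]) F) F) F.

Definition opposite_path_check (a m p q : nat) (F : seq nat) : bool :=
  if F is p' :: t then
    [&& p' == p, last p t == q, path nat_adj p t & all (gtn n) F] &&
    (a \notin F) && (m \notin F)
  else false.

(** Only faces are tried as cycles. A face is rotated to start at [a] and its remainder read in both
    directions, since [p] and [q] come in either order. *)
Definition opposite_cycles_check (Q : nat -> nat -> nat -> bool) : bool :=
  all (face_check Q) faces &&
  all (fun a => let N := [seq i <- iota 0 n | nat_adj a i] in
    all (fun m => all (fun p => all (fun q =>
      [|| m == p, m == q, p == q |
       has (fun F => let F' := behead (rot (index a F) F) in
         (a \in F) && (opposite_path_check a m p q F' ||
                       opposite_path_check a m p q (rev F')))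
         faces]) N) N) N) (iota 0 n).

Lemma opposite_cycles_checkP (Q : nat -> nat -> nat -> bool) (P : G -> G -> G -> Prop) :
  (forall x y z : G, Q (val x) (val y) (val z) -> P x y z) ->
  opposite_cycles_check Q -> opposite_cycles P.
Proof.
move=> QP /andP[/allP face_ok /allP check] a m p q am ap aq mp mq pq.
have iotaE (u : G) : val u \in iota 0 n by rewrite mem_iota add0n ltn_ord.
have N (u : G) : adj a u -> val u \in [seq i <- iota 0 n | nat_adj (val a) i].
  by rewrite mem_filter iotaE andbT.
have /allP/(_ _ (N m am))/allP/(_ _ (N p ap))/allP/(_ _ (N q aq)) := check _ (iotaE a).
rewrite !(inj_eq val_inj) (negPf mp) (negPf mq) (negPf pq) /= => /hasP[F Ffaces].
move=> /andP[aF chk]; have /andP[conn /allP triples] := face_ok F Ffaces.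
have rotE : val a :: behead (rot (index (val a) F) F) = rot (index (val a) F) F.
  by rewrite rot_index.
have [F' memF {}chk] : exists2 F', val a :: F' =i F &
    opposite_path_check (val a) (val m) (val p) (val q) F'.
  case/orP: chk => chk; last first.
    exists (rev (behead (rot (index (val a) F) F))) => // i.
    by rewrite in_cons mem_rev -in_cons rotE mem_rot.
  by exists (behead (rot (index (val a) F) F)) => // i; rewrite rotE mem_rot.
case: F' chk memF => [//|p' t0] /andP[/andP[/and4P[/eqP -> /eqP tq pt /andP[_ tn]] aN] mN] memF.
have [t tE] : exists t : seq G, t0 = map val t.
  exists (pmap insub t0); rewrite (pmap_filter (insubK _)).
  by apply/esym/all_filterP; apply: sub_all tn => i; rewrite isSome_insub.
have cE : map val (a :: p :: t) =i F by move=> i; rewrite -memF tE.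
have mapE (u : G) s : (val u \in map val s) = (u \in s) by apply/mem_map/val_inj.
have ptE : val p :: t0 = map val (p :: t) by rewrite tE.
exists t; split; [split|split].
- by apply: val_inj; rewrite -last_map -tE.
- by move: pt; rewrite tE path_map.
- by rewrite -mapE -ptE.
- by rewrite -mapE -ptE.
- exact: off_connected_checkP cE conn.
- move=> x y z xC yC zC xy xz yz; apply: QP.
  rewrite -!mapE !cE in xC yC zC.
  move: (triples _ xC) => /allP/(_ _ yC)/allP/(_ _ zC).
  by rewrite !(inj_eq val_inj) (negPf xy) (negPf xz) (negPf yz).
Qed.

End SkeletonChecks.

Lemma cube_opposite_cycles : opposite_cycles (fun x y z : cube =>
  [\/ adj x y /\ adj y z, adj y z /\ adj z x | adj z x /\ adj x y]).
Proof.
pose adj' := nat_adj cube_faces.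
apply: (@opposite_cycles_checkP _ _ (fun x y z =>
    [|| adj' x y && adj' y z, adj' y z && adj' z x | adj' z x && adj' x y])).
  by move=> x y z /or3P[]/andP[h1 h2]; [constructor 1|constructor 2|constructor 3].
by vm_compute.
Qed.

Lemma dodecahedron_opposite_cycles : opposite_cycles (fun x y z : dodecahedron =>
  [\/ adj x y, adj y z | adj z x]).
Proof.
pose adj' := nat_adj dodecahedron_faces.
apply: (@opposite_cycles_checkP _ _ (fun x y z => [|| adj' x y, adj' y z | adj' z x])).
  by move=> x y z /or3P[] h; [constructor 1|constructor 2|constructor 3].
by vm_compute.
Qed.

Lemma affine_cover_number_ge (R : realType) (G : sgraph) m :
  (forall k, drawable_on_lines R G k -> (m <= k)%N) -> (m <= affine_cover_number R G)%N.
Proof. by move=> h; rewrite /affine_cover_number; case: ex_minnP => k /asboolP /h. Qed.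

Theorem proposition7 (R : realType) :
  (6 <= affine_cover_number R tetrahedron)%N /\
  (9 <= affine_cover_number R octahedron)%N /\
  (7 <= affine_cover_number R cube)%N /\
  (9 <= affine_cover_number R dodecahedron)%N /\
  (13 <= affine_cover_number R icosahedron)%N.
Proof.
have deg n faces d : regular_check n faces d ->
    forall v : skeleton n faces, #|nbrs v| = d := @regular_checkP n faces d.
split; last split; last split; last split;
  apply: affine_cover_number_ge => k [f [L [cf lines cover]]].
- apply: (regular_lower_bound cf lines cover (d := 3)); rewrite ?card_ord //.
  by apply: deg; vm_compute.
- apply: (regular_lower_bound cf lines cover (d := 4)); rewrite ?card_ord //.
  by apply: deg; vm_compute.
- apply: (cube_lower_bound cf lines cover); [|exact: card_ord|exact: cube_opposite_cycles].
  by apply: deg; vm_compute.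
- apply: (dodecahedron_lower_bound cf lines cover);
    [|exact: card_ord|exact: dodecahedron_opposite_cycles].
  by apply: deg; vm_compute.
- apply: (icosahedron_lower_bound cf lines cover); last exact: card_ord.
  by apply: deg; vm_compute.
Qed.
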